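(* Let $\mathbb K$ be an algebraically closed field of characteristic $\ne 2$, let $n\ge2$ and $\mathfrak g=\mathfrak{sp}_{2n}$. Then for any nilpotent element $e\in\mathfrak g$, the set $(\mathfrak g_e^* )_{\rm sing}$ has codimension $\ge 2$ in $\mathfrak g_e^*$.
   Context: $\mathfrak g_e$ is the centraliser of $e$ in $\mathfrak g$. For a finite-dimensional Lie algebra $\mathfrak q$ and $\gamma\in\mathfrak q^*$, $\mathfrak q^\gamma=\{x\in\mathfrak q:\gamma([x,\mathfrak q])=0\}$, ${\rm ind}\,\mathfrak q=\min_\gamma\dim\mathfrak q^\gamma$, and $(\mathfrak q^* )_{\rm sing}=\{\gamma\in\mathfrak q^*:\dim\mathfrak q^\gamma>{\rm ind}\,\mathfrak q\}$. *)

(* Defs.v *)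
From HB Require Import structures.
From mathcomp Require Import all_boot all_order all_algebra.
From mathcomp Require Import mpoly.
Set Implicit Arguments. Unset Strict Implicit. Unset Printing Implicit Defensive.
Import Order.TTheory GRing.Theory.
Local Open Scope ring_scope.

Definition zariski_closed (K : fieldType) (d : nat) (Z : ('I_d -> K) -> Prop) :=
  exists S : {mpoly K[d]} -> Prop,
    forall v, Z v <-> (forall p, S p -> p.@[v] = 0).

Definition zariski_irreducible (K : fieldType) (d : nat) (Z : ('I_d -> K) -> Prop) :=
  zariski_closed Z /\ (exists v, Z v) /\
  forall Z1 Z2 : ('I_d -> K) -> Prop, zariski_closed Z1 -> zariski_closed Z2 ->
    (forall v, Z v <-> (Z1 v \/ Z2 v)) ->
    (forall v, Z v -> Z1 v) \/ (forall v, Z v -> Z2 v).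

Definition strict_subset (T : Type) (A B : T -> Prop) :=
  (forall x, A x -> B x) /\ exists x, B x /\ ~ A x.

(* (Krull) dimension bound: every strictly increasing chain
   Z_0 < Z_1 < ... < Z_m of irreducible closed subsets contained in X has
   m <= k.  "codim X >= c in K^d" means dim X <= d - c, i.e. m + c <= d for
   every such chain (vacuous if X is empty). *)
Definition codim_ge (K : fieldType) (d c : nat) (X : ('I_d -> K) -> Prop) :=
  forall (m : nat) (Z : nat -> ('I_d -> K) -> Prop),
    (forall i, (i <= m)%N -> zariski_irreducible (Z i)) ->
    (forall i, (i < m)%N -> strict_subset (Z i) (Z i.+1)) ->
    (forall v, Z m v -> X v) ->
    (m + c <= d)%N.

Definition symp_J (K : fieldType) (n : nat) : 'M[K]_(n + n) :=
  block_mx 0 1%:M (- 1%:M) 0.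

Definition in_sp (K : fieldType) (n : nat) (X : 'M[K]_(n + n)) :=
  X^T *m symp_J K n + symp_J K n *m X = 0.

Definition lie_br (K : fieldType) (N : nat) (X Y : 'M[K]_N) : 'M[K]_N :=
  X *m Y - Y *m X.

Definition is_basis_centraliser (K : fieldType) (n d : nat)
    (e : 'M[K]_(n + n)) (B : 'M[K]_(d, (n + n) * (n + n))) :=
  row_free B /\
  forall X : 'M[K]_(n + n),
    (mxvec X <= B)%MS <-> (in_sp X /\ lie_br X e = 0).

Definition bas (K : fieldType) (N d : nat) (B : 'M[K]_(d, N * N)) (i : 'I_d)
  : 'M[K]_N := vec_mx (row i B).

(* The linear form gamma in dual(g_e) with gamma(b_i) = c i, evaluated on Y in g_e
   (coordinates of Y in the basis B are  mxvec Y *m pinvmx B). *)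
Definition gam (K : fieldType) (N d : nat) (B : 'M[K]_(d, N * N))
    (c : 'I_d -> K) (Y : 'M[K]_N) : K :=
  \sum_i (mxvec Y *m pinvmx B) 0 i * c i.

Definition gam_form (K : fieldType) (N d : nat) (B : 'M[K]_(d, N * N))
    (c : 'I_d -> K) : 'M[K]_d :=
  \matrix_(i, j) gam B c (lie_br (bas B i) (bas B j)).

(* dim (g_e)^gamma, where (g_e)^gamma = { x in g_e : gamma([x, g_e]) = 0 };
   in coordinates u (x = u B) this is { u : u *m gam_form = 0 } = kermx. *)
Definition stab_dim (K : fieldType) (N d : nat) (B : 'M[K]_(d, N * N))
    (c : 'I_d -> K) : nat :=
  \rank (kermx (gam_form B c)).

(* (g_e^* )_sing = { gamma : dim (g_e)^gamma > ind g_e = min_gamma' dim (g_e)^gamma' } *)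
Definition sing_set (K : fieldType) (N d : nat) (B : 'M[K]_(d, N * N))
    (c : 'I_d -> K) : Prop :=
  exists c' : 'I_d -> K, (stab_dim B c' < stab_dim B c)%N.

(* Main.v *)
Require Import Defs.
From HB Require Import structures.
From mathcomp Require Import all_boot all_order all_algebra.
From mathcomp Require Import mpoly.
From mathcomp Require Import zify.
From Stdlib Require Import Classical.

(** Proof idea. A linear form on the centraliser [g_e] is [tr (x * _)] with [x] in [sp_2n].
    Every stabiliser has dimension at least [n]: commuting elements of [e + t x + O(t^2)]
    degenerate, at [t = 0], to elements of the stabiliser of [tr (x * _)]; odd powers give
    elements of [sp_2n], even powers self-adjoint elements.

    In a symplectic Jordan basis [w_i e^s] with block sizes in decreasing order, a matrix
    [X = (x_ij)] defines the form [y |-> sum_ij x_ij (coefficient of w_j e^(D_j - 1) in w_i y)].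
    If [X] is upper Hessenberg with nonzero subdiagonal, an element of the stabiliser in the
    centraliser of [e] in [gl_2n] that kills [w_0] vanishes; if [X] is diagonal with distinct
    nonzero entries, the same holds with [sum_i w_i] instead of [w_0]. So these stabilisers have
    dimension at most [2n], hence, the self-adjoint part taking up at least [n], the stabiliser
    in [g_e] has dimension at most [n]. Forms of both kinds span a plane whose
    nonzero points are all regular.

    A set defined by a drop of rank of a matrix of linear forms that meets a plane only at [0]
    has codimension at least [2]: on it, the two coordinates of the plane are integral over the
    other [d - 2] coordinates, so that polynomials of degree at most [Q] restrict to a space of
    dimension [O(Q^(d - 2))], while a chain of [m + 1] irreducible closed subsets provides [m]
    algebraically independent functions. *)

Set Implicit Arguments.
Unset Strict Implicit.
Unset Printing Implicit Defensive.
Import GRing.Theory.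
Local Open Scope ring_scope.

(** * Codimension of rank drops *)

(** Euclid's algorithm: a nonconstant [g] in [I] has a root [t], and a member of [I] not vanishing
    at [t] leaves a nonzero remainder modulo [g], of smaller degree. *)
Lemma ideal_of_polys_without_common_root (K : closedFieldType) (I : {poly K} -> Prop) :
  (forall p q, I p -> I q -> I (p + q)) -> (forall p q, I q -> I (p * q)) ->
  (forall t, exists2 p, I p & p.[t] != 0) -> I 1.
Proof.
move=> ID IM Iroot.
have [p0 Ip0 p0nz] := Iroot 0.
have {p0nz} : p0 != 0 by apply: contraNneq p0nz => ->; rewrite horner0.
have [n] := ubnP (size p0); elim: n p0 Ip0 => // n IHn g Ig ltgn gnz.
have [/size_poly1P[c cnz gE] | g1] := boolP (size g == 1%N).
  have -> : 1 = c^-1%:P * g :> {poly K} by rewrite gE -polyCM mulVf.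
  exact: IM.
have [t rt] := closed_rootP g g1; have [p Ip pt] := Iroot t.
have Imod : I (p %% g).
  by have -> : p %% g = p + (- (p %/ g)) * g;
     [rewrite {2}(divp_eq p g) mulNr addrC addKr | apply: ID => //; apply: IM].
apply: (IHn _ Imod).
  by rewrite (leq_trans _ (ltgn : (size g <= n)%N)) // ltn_modp.
apply: contraNneq pt => modp0.
by rewrite (divp_eq p g) modp0 addr0 hornerM (rootP rt) mulr0.
Qed.

(** * Leading parts in two coordinates *)

Section Low.
Context (K : fieldType) (d : nat) (u v : 'I_d).
Implicit Types (p q : {mpoly K[d]}) (m : 'X_{1..d}) (r s : nat).

Definition uvdeg m := (m u + m v)%N.

Definition deg_le r p := {in msupp p, forall m, (mdeg m <= r)%N}.

(** For [u != v], the monomials of degree [r] in [p] all involve a third coordinate; such [p] are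
    the right sides of the integral equations below. *)
Definition uvdeg_lt r p :=
  {in msupp p, forall m, (mdeg m <= r)%N /\ (uvdeg m < r)%N}.

(** This is [u ^ r * p (v / u)], with [p] truncated after the coefficient of index [r]. *)
Definition uvhom r (p : {poly K}) : {mpoly K[d]} :=
  \sum_(b < r.+1) p`_b *: ('X_u ^+ (r - b) * 'X_v ^+ b).

Lemma deg_leD r p q : deg_le r p -> deg_le r q -> deg_le r (p + q).
Proof.
by move=> hp hq m /msuppD_le; rewrite mem_cat => /orP[/hp|/hq].
Qed.

Lemma deg_leM r s p q : deg_le r p -> deg_le s q -> deg_le (r + s) (p * q).
Proof.
move=> hp hq m /msuppM_le/allpairsP[[m1 m2] /= [/hp h1 /hq h2 ->]].
by rewrite mdegD leq_add.
Qed.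

Lemma deg_leZ r c p : deg_le r p -> deg_le r (c *: p).
Proof. by move=> hp m /msuppZ_le/hp. Qed.

Lemma deg_leX m : deg_le (mdeg m) 'X_[m].
Proof. by move=> m'; rewrite msuppX inE => /eqP ->. Qed.

Lemma deg_le1 : deg_le 0 1.
Proof. by move=> m; rewrite msupp1 inE => /eqP ->; rewrite mdeg0. Qed.

Lemma deg_le_exp p r k : deg_le r p -> deg_le (r * k) (p ^+ k).
Proof.
move=> hp; elim: k => [|k IHk]; first by rewrite muln0; apply: deg_le1.
by rewrite exprS mulnS; apply: deg_leM.
Qed.

Lemma deg_leW r s p : (r <= s)%N -> deg_le r p -> deg_le s p.
Proof. by move=> rs hp m /hp /leq_trans; apply. Qed.

Lemma deg_leU i k : deg_le k ('X_i ^+ k).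
Proof.
by rewrite -[k in X in deg_le X _]mul1n; apply: deg_le_exp; rewrite -(mdeg1 i); apply: deg_leX.
Qed.

Lemma deg_le_sum r (I : Type) (l : seq I) (P : pred I) F :
  (forall i, P i -> deg_le r (F i)) -> deg_le r (\sum_(i <- l | P i) F i).
Proof.
move=> h; elim/big_ind: _ => //; last exact: deg_leD.
by move=> m; rewrite msupp0 in_nil.
Qed.

Lemma uvdeg_ltD r p q : uvdeg_lt r p -> uvdeg_lt r q -> uvdeg_lt r (p + q).
Proof.
by move=> hp hq m /msuppD_le; rewrite mem_cat => /orP[/hp|/hq].
Qed.

Lemma uvdeg_le_mdeg (uv : u != v) m : (uvdeg m <= mdeg m)%N.
Proof.
rewrite mdegE (bigD1 u) //= (bigD1 v) /=; last by rewrite eq_sym.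
by rewrite addnA leq_addr.
Qed.

Lemma uvdeg_ltM (uv : u != v) r s p q :
  uvdeg_lt r p -> deg_le s q -> uvdeg_lt (r + s) (p * q).
Proof.
move=> hp hq m /msuppM_le/allpairsP[[m1 m2] /= [/hp[h1 h1'] /hq h2 ->]].
rewrite mdegD leq_add //; split=> //.
rewrite /uvdeg !mnmDE addnACA -addSn leq_add //.
exact: leq_trans (uvdeg_le_mdeg uv _) h2.
Qed.

Lemma uvdeg_lt_sum r (I : Type) (l : seq I) (P : pred I) F :
  (forall i, P i -> uvdeg_lt r (F i)) -> uvdeg_lt r (\sum_(i <- l | P i) F i).
Proof.
move=> h; elim/big_ind: _ => //; last exact: uvdeg_ltD.
by move=> m; rewrite msupp0 in_nil.
Qed.

Lemma uvdeg_ltZ r c p : uvdeg_lt r p -> uvdeg_lt r (c *: p).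
Proof. by move=> hp m /msuppZ_le/hp. Qed.

Lemma uvhomD r (p q : {poly K}) : uvhom r (p + q) = uvhom r p + uvhom r q.
Proof.
by rewrite /uvhom -big_split; apply: eq_bigr => b _ /=; rewrite coefD scalerDl.
Qed.

Lemma uvhomZ r c (p : {poly K}) : uvhom r (c *: p) = c *: uvhom r p.
Proof.
by rewrite /uvhom scaler_sumr; apply: eq_bigr => b _ /=; rewrite coefZ scalerA.
Qed.

Lemma uvhom0 r : uvhom r 0 = 0.
Proof. by rewrite /uvhom big1 // => b _; rewrite coef0 scale0r. Qed.

Lemma uvhom_sum r (I : Type) (l : seq I) (P : pred I) (F : I -> {poly K}) :
  uvhom r (\sum_(i <- l | P i) F i) = \sum_(i <- l | P i) uvhom r (F i).
Proof. by apply: big_morph; [exact: uvhomD | exact: uvhom0]. Qed.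

Lemma uvhomX r b : (b <= r)%N -> uvhom r 'X^b = 'X_u ^+ (r - b) * 'X_v ^+ b.
Proof.
move=> br; rewrite /uvhom (bigD1 (Ordinal (br : (b < r.+1)%N))) //=.
rewrite coefXn eqxx scale1r big1 ?addr0 // => c /eqP cb.
by rewrite coefXn; case: eqP => [E|]; [case: cb; apply: val_inj | rewrite scale0r].
Qed.

Lemma uvhom1 r : uvhom r 1 = 'X_u ^+ r.
Proof. by rewrite -(expr0 'X) uvhomX // subn0 expr0 mulr1. Qed.

Lemma poly_sum_bound (R : nzRingType) r (p : {poly R}) : (size p <= r.+1)%N ->
  p = \sum_(i < r.+1) p`_i *: 'X^i.
Proof. by move=> h; rewrite -poly_def; apply/esym/polyP => i; rewrite coef_poly; case: ltnP => // /(leq_trans h) hh; rewrite nth_default. Qed.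

(** Under the size bounds nothing is truncated, and the identity is checked on pairs of
    monomials. *)
Lemma uvhomM r s (p q : {poly K}) : (size p <= r.+1)%N -> (size q <= s.+1)%N ->
  uvhom (r + s) (p * q) = uvhom r p * uvhom s q.
Proof.
move=> hp hq; rewrite {1}(poly_sum_bound hp) {1}(poly_sum_bound hq).
rewrite mulr_suml uvhom_sum [uvhom r p]/uvhom mulr_suml; apply: eq_bigr => i _.
rewrite mulr_sumr uvhom_sum [uvhom s q]/uvhom mulr_sumr; apply: eq_bigr => j _.
rewrite -scalerAl -scalerAr scalerA -exprD uvhomZ uvhomX; last first.
  by apply: leq_add; rewrite -ltnS.
rewrite -scalerAl -scalerAr scalerA mulrACA -!exprD; congr (_ *: (_ ^+ _ * _)).
by rewrite addnBA -1?ltnS // addnBAC -1?ltnS // subnDA.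
Qed.

Lemma deg_le_uvhom r (p : {poly K}) : deg_le r (uvhom r p).
Proof.
apply: deg_le_sum => b _; apply: deg_leZ.
rewrite -{1}(subnK (ltn_ord b : (b <= r)%N)).
by apply: deg_leM; apply: deg_leU.
Qed.

(* Where the coordinates other than [u] and [v] vanish, [p] is the homogenisation of [f] in
   degree [r]. *)
Definition uvlead r p (f : {poly K}) :=
  (size f <= r.+1)%N /\ uvdeg_lt r (p - uvhom r f).

Lemma uvlead_deg_le r p f : uvlead r p f -> deg_le r p.
Proof.
case=> _ h; rewrite -(subrK (uvhom r f) p); apply: deg_leD; last exact: deg_le_uvhom.
by move=> m /h[].
Qed.

Lemma uvleadD r p q f g : uvlead r p f -> uvlead r q g -> uvlead r (p + q) (f + g).
Proof.
move=> [sf hf] [sg hg]; split.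
  by rewrite (leq_trans (size_polyD _ _)) // geq_max sf.
by rewrite uvhomD opprD addrACA; apply: uvdeg_ltD.
Qed.

Lemma uvlead0 r : uvlead r 0 0.
Proof. by split; rewrite ?size_poly0 // uvhom0 subrr => m; rewrite msupp0. Qed.

Lemma uvleadZ r c p f : uvlead r p f -> uvlead r (c *: p) (c *: f).
Proof.
move=> [sf hf]; split; first exact: leq_trans (size_scale_leq _ _) sf.
by rewrite uvhomZ -scalerBr; apply: uvdeg_ltZ.
Qed.

Lemma uvleadM (uv : u != v) r s p q f g :
  uvlead r p f -> uvlead s q g -> uvlead (r + s) (p * q) (f * g).
Proof.
move=> hp hq; have bq := uvlead_deg_le hq; case: hp hq => [sf hf] [sg hg]; split.
  rewrite (leq_trans (size_polyMleq _ _)) //.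
  by rewrite -subn1 leq_subLR add1n -addnS -addSn leq_add.
rewrite uvhomM //.
have -> : p * q - uvhom r f * uvhom s g =
  (p - uvhom r f) * q + (q - uvhom s g) * uvhom r f.
  by rewrite mulrBl mulrBl [q * _]mulrC addrA subrK [uvhom s g * _]mulrC.
apply: uvdeg_ltD; first exact: uvdeg_ltM.
by rewrite addnC; apply: uvdeg_ltM => //; apply: deg_le_uvhom.
Qed.

Lemma uvlead_uvhom r (f : {poly K}) : (size f <= r.+1)%N -> uvlead r (uvhom r f) f.
Proof. by split=> //; rewrite subrr => m; rewrite msupp0. Qed.

Lemma uvlead_det (uv : u != v) r (A : 'M[{mpoly K[d]}]_r) (B : 'M[{poly K}]_r) :
  (forall i j, uvlead 1 (A i j) (B i j)) -> uvlead r (\det A) (\det B).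
Proof.
move=> h; rewrite /determinant.
apply: (big_ind2 (uvlead r)); [exact: uvlead0 | by move=> *; apply: uvleadD |].
move=> s _.
have sgA (b : bool) (x : {mpoly K[d]}) : (-1) ^+ b * x = (-1) ^+ b *: x.
  by case: b; rewrite ?expr0 ?mul1r ?scale1r // expr1 mulN1r scaleN1r.
have sgB (b : bool) (x : {poly K}) : (-1) ^+ b * x = (-1) ^+ b *: x.
  by case: b; rewrite ?expr0 ?mul1r ?scale1r // expr1 mulN1r scaleN1r.
rewrite sgA sgB.
(* The degree [r] becomes a sum of ones over the rows, so that one induction follows the degree and
   both products together. *)
apply: uvleadZ; rewrite -[r in uvlead r]card_ord -sum1_card.
pose Q (x : nat) p f := uvlead x p f.
rewrite -[uvlead _ _ _]/(Q _ _ _).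
elim/big_rec3: _ => [|i y1 y2 x _ H]; rewrite /Q.
  by rewrite -(expr0 'X_u) -(uvhom1 0); apply: uvlead_uvhom; rewrite size_poly1.
exact: uvleadM.
Qed.

End Low.

(** * Reduction of polynomials by two integral equations *)

Section Span.
Context (K : fieldType) (d : nat) (u v : 'I_d) (uv : u != v).
Context (Y : ('I_d -> K) -> Prop) (M : nat) (lu lv : {mpoly K[d]}).
Hypothesis (lu_lt : uvdeg_lt u v M lu) (lv_lt : uvdeg_lt u v M lv).
Hypothesis (lu_eq : forall w, Y w -> w u ^+ M = lu.@[w]).
Hypothesis (lv_eq : forall w, Y w -> w v ^+ M = lv.@[w]).
Implicit Types (p q : {mpoly K[d]}) (m : 'X_{1..d}).

(** Exponents of the reduced monomials, which the two integral equations no longer rewrite; their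
    number grows like [Q ^ (d - 2)]. *)
Definition red_index (Q : nat) : finType :=
  ({ffun {j : 'I_d | j \in predC (pred2 u v)} -> 'I_Q.+1} * ('I_M * 'I_M))%type.

Definition red_mon Q (a : red_index Q) (w : 'I_d -> K) : K :=
  (\prod_(j : {j : 'I_d | j \in predC (pred2 u v)}) w (val j) ^+ a.1 j)
  * (w u ^+ a.2.1 * w v ^+ a.2.2).

Lemma card_red_index Q : #|red_index Q| = (Q.+1 ^ (d - 2) * M ^ 2)%N.
Proof.
rewrite !card_prod card_ffun !card_ord card_sig; congr (_ ^ _ * _)%N.
have := cardC (pred2 u v); rewrite card2 uv card_ord => E.
by rewrite -[in RHS]E addKn; apply: eq_card.
Qed.

Definition red_spanned Q (g : ('I_d -> K) -> K) :=
  exists la : red_index Q -> K, forall w, Y w -> g w = \sum_a la a * red_mon a w.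

Lemma red_spanned_sum Q (I : eqType) (l : seq I) (c : I -> K) (g : I -> ('I_d -> K) -> K) :
  (forall i, i \in l -> red_spanned Q (g i)) ->
  red_spanned Q (fun w => \sum_(i <- l) c i * g i w).
Proof.
elim: l => [_|i l IHl H].
  by exists (fun=> 0) => w _; rewrite big_nil big1 // => a _; rewrite mul0r.
have [|la hla] := IHl; first by move=> j jl; apply: H; rewrite inE jl orbT.
have [|mu hmu] := H i; first by rewrite mem_head.
exists (fun a => c i * mu a + la a) => w Yw.
rewrite big_cons hla // hmu // mulr_sumr -big_split /=.
by apply: eq_bigr => a _; rewrite mulrDl mulrA.
Qed.

Lemma red_spanned_ext Q (g h : ('I_d -> K) -> K) :
  (forall w, Y w -> g w = h w) -> red_spanned Q h -> red_spanned Q g.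
Proof. by move=> gh [la hla]; exists la => w Yw; rewrite gh // hla. Qed.

Lemma mnm_le_mdeg m i : (m i <= mdeg m)%N.
Proof. by rewrite mdegE (bigD1 i) //= leq_addr. Qed.

Lemma red_spanned_mon_reduced Q m : (mdeg m <= Q)%N -> (m u < M)%N -> (m v < M)%N ->
  red_spanned Q (fun w => ('X_[m] : {mpoly K[d]}).@[w]).
Proof.
move=> mQ mu mv.
have mi i : (m i < Q.+1)%N by rewrite ltnS (leq_trans (mnm_le_mdeg m i)).
pose a : red_index Q := ([ffun j => Ordinal (mi (val j))], (Ordinal mu, Ordinal mv)).
exists (fun b => (b == a)%:R) => w _.
rewrite (bigD1 a) //= eqxx mul1r big1 ?addr0; last by move=> b /negPf ->; rewrite mul0r.
rewrite mevalX (bigD1 u) //= (bigD1 v) /=; last by rewrite eq_sym.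
rewrite mulrA mulrC /red_mon /=; congr (_ * _).
transitivity (\prod_(i in predC (pred2 u v)) w i ^+ m i).
  by apply: eq_bigl => i; rewrite !inE negb_or.
by rewrite big_sub; apply: eq_big => // i _; rewrite ffunE.
Qed.

(** The condition on [U_(i)] says that [i] is [u] or [v]. Substituting [l] for the [M]-th power of
    this coordinate does not raise the total degree and lowers the degree in [u] and [v]. *)
Lemma red_spanned_step Q (i : 'I_d) (l : {mpoly K[d]}) m :
  (forall w, Y w -> w i ^+ M = l.@[w]) -> uvdeg_lt u v M l -> uvdeg u v U_(i)%MM = 1%N ->
  (forall m', (mdeg m' <= Q)%N -> (uvdeg u v m' < uvdeg u v m)%N ->
     red_spanned Q (fun w => ('X_[m'] : {mpoly K[d]}).@[w])) ->
  (mdeg m <= Q)%N -> (M <= m i)%N ->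
  red_spanned Q (fun w => ('X_[m] : {mpoly K[d]}).@[w]).
Proof.
move=> l_eq l_lt ui IH mQ Mi.
pose m0 := (m - U_(i) *+ M)%MM.
have mE : m = (U_(i) *+ M + m0)%MM.
  rewrite addmC submK //; apply/mnm_lepP => j; rewrite mulmnE mnm1E.
  by case: eqP => [<-|_]; rewrite ?mul1n ?mul0n.
have uvE m' : uvdeg u v (m' + m0)%MM = (uvdeg u v m' + uvdeg u v m0)%N.
  by rewrite /uvdeg !mnmDE addnACA.
have uvM : uvdeg u v (U_(i) *+ M)%MM = M.
  by rewrite /uvdeg !mulmnE -mulnDl -/(uvdeg u v U_(i)%MM) ui mul1n.
apply: (@red_spanned_ext _ _
  (fun w => \sum_(m' <- msupp l) l@_m' * ('X_[m' + m0] : {mpoly K[d]}).@[w])).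
  move=> w Yw; rewrite mE mpolyXD mevalM -mpolyXn rmorphXn /= mevalXU l_eq //.
  rewrite {1}[l]mpolyE raddf_sum /= mulr_suml; apply: eq_bigr => m' _.
  by rewrite mpolyXD mevalM mevalZ mulrA.
apply: red_spanned_sum => m' /l_lt[dm um]; apply: IH.
  by rewrite mdegD (leq_trans _ mQ) // mE mdegD leq_add2r mdegMn mdeg1 mul1n.
by rewrite uvE mE uvE ltn_add2r uvM.
Qed.

Lemma red_spanned_mon Q m : (mdeg m <= Q)%N ->
  red_spanned Q (fun w => ('X_[m] : {mpoly K[d]}).@[w]).
Proof.
have [k] := ubnP (uvdeg u v m); elim: k m => // k IHk m mk mQ.
have vu : (v == u) = false by rewrite eq_sym (negPf uv).
have IH m' : (mdeg m' <= Q)%N -> (uvdeg u v m' < uvdeg u v m)%N ->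
     red_spanned Q (fun w => ('X_[m'] : {mpoly K[d]}).@[w]).
  by move=> m'Q m'm; apply: IHk => //; apply: leq_trans m'm _.
have [mu|mu] := ltnP (m u) M; last first.
  by apply: (red_spanned_step lu_eq lu_lt) => //; rewrite /uvdeg !mnm1E eqxx (negPf uv).
have [mv|mv] := ltnP (m v) M; last first.
  by apply: (red_spanned_step lv_eq lv_lt) => //; rewrite /uvdeg !mnm1E eqxx vu.
exact: red_spanned_mon_reduced.
Qed.

Lemma red_spanned_mpoly Q p : deg_le Q p -> red_spanned Q (fun w => p.@[w]).
Proof.
move=> pQ; apply: (@red_spanned_ext _ _
  (fun w => \sum_(m <- msupp p) p@_m * ('X_[m] : {mpoly K[d]}).@[w])).
  move=> w _; rewrite {1}[p]mpolyE raddf_sum /=.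
  by apply: eq_bigr => m _; rewrite mevalZ.
by apply: red_spanned_sum => m /pQ; apply: red_spanned_mon.
Qed.

(** There are more polynomials than reduced monomials, so the matrix of their reductions has a
    nonzero left kernel. *)
Lemma dependent_on_set Q (I : finType) (g : I -> {mpoly K[d]}) :
  (forall i, deg_le Q (g i)) -> (Q.+1 ^ (d - 2) * M ^ 2 < #|I|)%N ->
  exists2 nu : I -> K, (exists i, nu i != 0) &
    forall w, Y w -> \sum_i nu i * (g i).@[w] = 0.
Proof.
move=> gQ; rewrite -card_red_index => ltI.
have [la hla] := fin_all_exists (fun i => red_spanned_mpoly (gQ i)).
pose L := \matrix_(i < #|I|, j < #|red_index Q|) la (enum_val i) (enum_val j).
have : kermx L != 0.
  rewrite -mxrank_eq0 mxrank_ker subn_eq0 -ltnNge.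
  exact: leq_ltn_trans (rank_leq_col _) ltI.
case/rowV0Pn => r /sub_kermxP rL /rV0Pn[i0 ri0].
exists (fun i => r 0 (enum_rank i)); first by exists (enum_val i0); rewrite enum_valK.
move=> w Yw.
transitivity (\sum_i \sum_a r 0 (enum_rank i) * la i a * red_mon a w).
  apply: eq_bigr => i _; rewrite hla // mulr_sumr.
  by apply: eq_bigr => a _; rewrite mulrA.
rewrite exchange_big /= big1 // => a _; rewrite -mulr_suml.
have /matrixP/(_ 0 (enum_rank a)) := rL; rewrite !mxE => E.
rewrite (reindex_onto enum_val enum_rank) /=; last by move=> i _; rewrite enum_rankK.
rewrite -[RHS](mul0r (red_mon a w)) -{2}E; congr (_ * _).
by apply: eq_big => [i|i _]; rewrite ?enum_valK ?eqxx // !mxE enum_rankK.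
Qed.

End Span.

(** * Algebraic independence along a chain *)

Section Chain.
Context (K : fieldType) (d : nat) (Z : nat -> ('I_d -> K) -> Prop).
Context (f : nat -> {mpoly K[d]}) (q : nat).

Fixpoint pow_index m : finType :=
  if m is m'.+1 then ('I_q * pow_index m')%type else unit.

(** Monomials in [f 1, ..., f m]; the index starts at one because [f i.+1] separates [Z i] from
    [Z i.+1]. *)
Fixpoint pow_mon m : pow_index m -> {mpoly K[d]} :=
  match m return pow_index m -> {mpoly K[d]} with
  | 0 => fun=> 1
  | m'.+1 => fun a => f m'.+1 ^+ a.1 * pow_mon a.2
  end.

Lemma card_pow_index m : #|pow_index m| = (q ^ m)%N.
Proof. by elim: m => [|m IHm]; rewrite ?card_unit //= card_prod card_ord IHm expnS. Qed.

Lemma deg_le_pow_mon D m (a : pow_index m) :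
  (forall i, (i <= m)%N -> deg_le D (f i)) -> deg_le (m * (D * q)) (pow_mon a).
Proof.
elim: m a => [|m IHm] a fD /=; first exact: deg_le1.
rewrite mulSn; apply: deg_leM; last by apply: IHm => i im; apply: fD; apply: leqW.
apply: (@deg_leW _ _ (D * a.1)); last exact/deg_le_exp/fD.
by rewrite leq_mul2l ltnW ?orbT.
Qed.

(** Induction along the chain. A relation on [Z m.+1] is a polynomial in [F = f m.+1] with
    coefficients [g b]. Its lowest power of [F] cancels, the vanishing ideal being prime and not
    containing [F]; on [Z m], where [F] vanishes, only the lowest coefficient is left. *)
Lemma pow_mon_free m :
  (exists w, Z 0 w) ->
  (forall i, (i <= m)%N -> forall p r : {mpoly K[d]},
    (forall w, Z i w -> (p * r).@[w] = 0) ->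
    (forall w, Z i w -> p.@[w] = 0) \/ (forall w, Z i w -> r.@[w] = 0)) ->
  (forall i, (i < m)%N -> forall w, Z i w -> Z i.+1 w) ->
  (forall i, (i < m)%N -> forall w, Z i w -> (f i.+1).@[w] = 0) ->
  (forall i, (i < m)%N -> ~ forall w, Z i.+1 w -> (f i.+1).@[w] = 0) ->
  forall nu : pow_index m -> K,
    (forall w, Z m w -> \sum_a nu a * (pow_mon a).@[w] = 0) -> forall a, nu a = 0.
Proof.
move=> [w0 Zw0]; elim: m => [|m IHm] Zp Zs f0 fn nu nu0 a.
  by have /= := nu0 _ Zw0; rewrite (bigD1 a) //= big1 ?addr0 ?meval1 ?mulr1 // => -[] /eqP; case: a.
have IH := IHm (fun i im => Zp i (leqW im)) (fun i im => Zs i (leqW im))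
  (fun i im => f0 i (leqW im)) (fun i im => fn i (leqW im)).
case: a => b a /=.
pose g b := \sum_a nu (b, a) *: pow_mon a.
pose F := f m.+1.
have nu1 w : Z m.+1 w -> \sum_(b < q) (F ^+ b * g b).@[w] = 0.
  move=> Zw; rewrite -[RHS](nu0 _ Zw); transitivity (\sum_(c < q) \sum_e nu (c, e) * (F ^+ c * pow_mon e).@[w]).
    2: by rewrite pair_bigA; apply: eq_bigr => -[].
  apply: eq_bigr => c _; rewrite mulr_sumr raddf_sum; apply: eq_bigr => e _ /=.
  by rewrite -scalerAr mevalZ.
have Fpow k (p : {mpoly K[d]}) : (forall w, Z m.+1 w -> (F ^+ k * p).@[w] = 0) ->
    forall w, Z m.+1 w -> p.@[w] = 0.
  elim: k => [|k IHk] H; first by move=> w /H; rewrite expr0 mul1r.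
  apply: IHk; have [||//] := Zp m.+1 (leqnn _) F (F ^+ k * p).
    by move=> w /H; rewrite exprS mulrA.
  by move/(fn m (ltnSn m)).
have [k] := ubnP (b : nat); elim: k b a => // k IHk b a bk.
apply: (IH (fun a => nu (b, a))) => w Zw.
(* The coefficients of index below [b] are already known to vanish, so the relation reads
   [F ^+ b * (g b + F * h)]. *)
pose h := \sum_(c < q | (b < c)%N) F ^+ (c - b.+1) * g c.
have gE w' : Z m.+1 w' -> (g b + F * h).@[w'] = 0.
  apply: (Fpow b) => {}w' Zw'; rewrite -[RHS](nu1 _ Zw') [RHS](bigD1 b) //=.
  rewrite mulrDr mevalD; congr (_ + _).
  rewrite mulrA -exprSr mulr_sumr raddf_sum /= [RHS](bigID (fun c : 'I_q => (b < c)%N)) /=.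
  rewrite [X in _ = _ + X]big1 ?addr0; last first.
    move=> c /andP[cb bc]; have -> : g c = 0; last by rewrite mulr0 meval0.
    rewrite /g big1 // => e _; rewrite IHk ?scale0r //.
    by rewrite (leq_trans _ (bk : (b <= k)%N)) // ltn_neqAle cb leqNgt.
  apply: eq_big => [c|c bc]; last by rewrite mulrA -exprD subnKC.
  by case: ltngtP => // bc; rewrite ?andbT ?andbF //; apply/esym; apply: contraTneq bc => ->; rewrite ltnn.
have := gE _ (Zs m (ltnSn m) _ Zw).
rewrite mevalD mevalM f0 // mul0r addr0 raddf_sum /= => E; rewrite -[RHS]E.
by apply: eq_bigr => e _; rewrite mevalZ.
Qed.

End Chain.

Lemma exists_exp_gt (c e m : nat) (k : nat) : (e < m)%N ->
  exists2 q, (0 < q)%N & ((c * q) ^ e * k < q ^ m)%N.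
Proof.
move=> em; exists (c ^ e * k).+1 => //.
rewrite expnMn mulnAC (leq_trans _ (leq_pexp2l _ em)) // expnS ltn_pmul2r //.
by rewrite expn_gt0.
Qed.

(** Counting: the [q ^ m] monomials in the separating functions have degree at most a constant times
    [q]. For [m > d - 2] and large [q] they outnumber the reduced monomials, so they satisfy a
    relation on [Y], against their independence on [Z m]. *)
Lemma chain_length_bound (K : fieldType) (d : nat) (u v : 'I_d)
    (Y : ('I_d -> K) -> Prop) (M : nat) (lu lv : {mpoly K[d]})
    (m : nat) (Z : nat -> ('I_d -> K) -> Prop) (f : nat -> {mpoly K[d]}) :
  u != v -> uvdeg_lt u v M lu -> uvdeg_lt u v M lv ->
  (forall w, Y w -> w u ^+ M = lu.@[w]) -> (forall w, Y w -> w v ^+ M = lv.@[w]) ->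
  (exists w, Z 0%N w) ->
  (forall i, (i <= m)%N -> forall p r : {mpoly K[d]},
    (forall w, Z i w -> (p * r).@[w] = 0) ->
    (forall w, Z i w -> p.@[w] = 0) \/ (forall w, Z i w -> r.@[w] = 0)) ->
  (forall i, (i < m)%N -> forall w, Z i w -> Z i.+1 w) ->
  (forall i, (i < m)%N -> forall w, Z i w -> (f i.+1).@[w] = 0) ->
  (forall i, (i < m)%N -> ~ forall w, Z i.+1 w -> (f i.+1).@[w] = 0) ->
  (forall w, Z m w -> Y w) -> (m + 2 <= d)%N.
Proof.
move=> uv lu_lt lv_lt lu_eq lv_eq Z0 Zp Zs f0 fn ZY; rewrite leqNgt; apply/negP => dm.
have d2 : (2 <= d)%N by rewrite -[leqRHS]card_ord -(cardC (pred2 u v)) card2 uv.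
have [D fD] : exists D, forall i, (i <= m)%N -> deg_le D (f i).
  exists (\max_(i < m.+1) msize (f i)) => i im p /msize_mdeg_lt/ltnW /leq_trans; apply.
  exact: (@leq_bigmax _ (fun i : 'I_m.+1 => msize (f i)) (Ordinal (im : (i < m.+1)%N))).
have em : (d - 2 < m)%N by rewrite ltn_subLR // addnC.
(* The constant is chosen so that [Q.+1 <= (m * D).+1 * q], which holds because [0 < q]. *)
have [q q0 hq] := exists_exp_gt (m * D).+1 (M ^ 2) em.
pose Q := (m * (D * q))%N.
have gQ (a : pow_index q m) : deg_le Q (pow_mon f a) by apply: deg_le_pow_mon.
have ltq : (Q.+1 ^ (d - 2) * M ^ 2 < #|pow_index q m|)%N.
  rewrite card_pow_index; apply: leq_ltn_trans hq; rewrite leq_mul2r; apply/orP; right.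
  case: (d - 2)%N => // e; rewrite leq_exp2r //.
  by rewrite mulSn /Q mulnA -add1n leq_add2r.
have [nu [a nua]] := dependent_on_set uv lu_lt lv_lt lu_eq lv_eq gQ ltq.
move=> nu0; case/eqP: nua; move: a.
by apply: (pow_mon_free Z0 Zp Zs f0 fn) => w /ZY/nu0.
Qed.

(** A determinant test for the rank without a choice of minor: the compression by the same [P] and
    [Q] of a matrix of rank below [r] is singular. *)
Lemma rank_ge_submx1 (K : fieldType) m n r (M : 'M[K]_(m, n)) : (r <= \rank M)%N ->
  exists P : 'M_(r, m), exists Q : 'M_(n, r), P *m M *m Q = 1%:M.
Proof.
move=> rM.
exists (pid_mx r *m invmx (col_ebase M)), (invmx (row_ebase M) *m pid_mx r).
rewrite -{2}(mulmx_ebase M) !mulmxA mulmxKV ?col_ebase_unit // mulmxK ?row_ebase_unit //.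
rewrite mul_pid_mx mul_pid_mx -[RHS](pid_mx_1 K r); congr pid_mx.
have rm := leq_trans rM (rank_leq_row M); have rn := leq_trans rM (rank_leq_col M).
by rewrite (minn_idPl rM) (minn_idPr rm) minnn (minn_idPr rn).
Qed.

Lemma uvlead_linear (K : fieldType) d (u v : 'I_d) (c : 'I_d -> K) : u != v ->
  uvlead u v 1 (\sum_l c l *: 'X_l) ((c u)%:P + c v *: 'X).
Proof.
move=> uv; split.
  rewrite (leq_trans (size_polyD _ _)) // geq_max (leq_trans (size_polyC_leq1 _)) //.
  by rewrite (leq_trans (size_scale_leq _ _)) // size_polyX.
have uvhom1X : uvhom u v 1 'X = 'X_v :> {mpoly K[d]}.
  by rewrite -[X in uvhom _ _ _ X]expr1 uvhomX // expr0 mul1r expr1.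
rewrite uvhomD uvhomZ uvhom1X.
rewrite -[(c u)%:P]mulr1 mul_polyC uvhomZ uvhom1 expr1.
rewrite (bigD1 u) //= (bigD1 v) /=; last by rewrite eq_sym.
rewrite addrA [_ + _ - _]addrAC. rewrite subrr add0r.
apply: uvdeg_lt_sum => i /andP[iu iv]; apply: uvdeg_ltZ => m.
by rewrite msuppX inE => /eqP ->; rewrite mdeg1 /uvdeg !mnm1E (negPf iu) (negPf iv).
Qed.

(** * Integrality over a set of rank drop *)

Section Pencil.
Context (K : closedFieldType) (d D r : nat) (G : 'I_d -> 'M[K]_D).

Definition lin_mx_at (w : 'I_d -> K) := \sum_l w l *: G l.

(** The leading polynomials, in the sense of [uvlead], of functions vanishing on [Y] form an ideal.
    For each [t], a compressed determinant of size [r] vanishes on [Y] and has leading polynomial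
    nonzero at [t]. So 1 is in the ideal, and a function with leading polynomial 1 expresses
    [w u ^+ M] by lower terms. *)
Lemma uv_integral (u v : 'I_d) (Y : ('I_d -> K) -> Prop) : u != v ->
  (forall w, Y w -> (\rank (lin_mx_at w) < r)%N) ->
  (forall t, (r <= \rank (G u + t *: G v)%R)%N) ->
  exists M l, uvdeg_lt u v M l /\ forall w, Y w -> w u ^+ M = l.@[w].
Proof.
move=> uv Yr Gr.
pose I p := exists M Psi, uvlead u v M Psi p /\ forall w, Y w -> Psi.@[w] = 0.
suff [M [Psi [[_ lead1] Psi0]]] : I 1.
  exists M, (- (Psi - uvhom u v M 1)); split.
    by rewrite -scaleN1r; apply: uvdeg_ltZ.
  by move=> w /Psi0 E; rewrite opprB mevalB E subr0 uvhom1 rmorphXn /= mevalXU.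
have IM p q : I q -> I (p * q).
  move=> [M [Psi [lead Psi0]]].
  exists (size p + M)%N, (uvhom u v (size p) p * Psi); split.
    by apply: uvleadM => //; apply: uvlead_uvhom.
  by move=> w /Psi0 E; rewrite mevalM E mulr0.
have I_homog M Psi (p : {poly K}) k : uvlead u v M Psi p -> uvlead u v (k + M) ('X_u ^+ k * Psi) p.
  move=> lead; rewrite -[p]mul1r; apply: uvleadM => //.
  by rewrite -(uvhom1 K u v k); apply: uvlead_uvhom; rewrite size_poly1.
apply: ideal_of_polys_without_common_root => //.
  move=> p q [M1 [Psi1 [lead1 E1]]] [M2 [Psi2 [lead2 E2]]].
  (* Powers of ['X_u] bring both functions to the same degree without changing their leading
     polynomials. *)
  exists (M2 + M1)%N, ('X_u ^+ M2 * Psi1 + 'X_u ^+ M1 * Psi2); split.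
    by apply: uvleadD; [|rewrite addnC]; apply: I_homog.
  by move=> w Yw; rewrite mevalD !mevalM E1 // E2 // !mulr0 addr0.
move=> t; have [P [Q PQ]] := rank_ge_submx1 (Gr t).
pose c l i j := (P *m G l *m Q) i j.
pose f : 'M[{poly K}]_r := \matrix_(i, j) ((c u i j)%:P + c v i j *: 'X).
exists (\det f).
  exists r, (\det (\matrix_(i, j) \sum_l c l i j *: 'X_l)); split.
    by apply: uvlead_det => // i j; rewrite !mxE; apply: uvlead_linear.
  move=> w /Yr rw; rewrite -det_map_mx.
  rewrite (_ : map_mx _ _ = P *m lin_mx_at w *m Q); last first.
    apply/matrixP => i j.
    rewrite /lin_mx_at mulmx_sumr mulmx_suml summxE !mxE raddf_sum; apply: eq_bigr => l _ /=.
    by rewrite mevalZ mevalXU -scalemxAr -scalemxAl mxE mulrC.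
  apply/eqP; rewrite -[_ == 0]negbK -unitfE -unitmxE -row_free_unit /row_free.
  rewrite neq_ltn (leq_ltn_trans _ rw) //.
  by rewrite (leq_trans (mxrankM_maxl _ _)) // mxrankM_maxr.
rewrite -[_.[t]]/(horner_eval t _) -det_map_mx.
rewrite (_ : map_mx _ _ = 1%:M) ?det1 ?oner_neq0 // -PQ.
apply/matrixP => i j.
rewrite mulmxDr mulmxDl -scalemxAr -scalemxAl [LHS]mxE [RHS]mxE [X in _ = _ + X]mxE.
by rewrite /= /horner_eval mxE hornerD hornerC hornerZ hornerX mulrC.
Qed.

Lemma uvdegC (u v : 'I_d) : uvdeg u v =1 uvdeg v u.
Proof. by move=> m; apply: addnC. Qed.

(** Each of the two charts of the projective line of the pencil gives one equation; further powers
    of the coordinates equalise the exponents. *)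
Lemma uv_integral2 (u v : 'I_d) (Y : ('I_d -> K) -> Prop) : u != v ->
  (forall w, Y w -> (\rank (lin_mx_at w) < r)%N) ->
  (forall s t, (s != 0) || (t != 0) -> (r <= \rank (s *: G u + t *: G v)%R)%N) ->
  exists M lu lv, [/\ uvdeg_lt u v M lu, uvdeg_lt u v M lv,
    forall w, Y w -> w u ^+ M = lu.@[w] & forall w, Y w -> w v ^+ M = lv.@[w]].
Proof.
move=> uv Yr Gr.
have [|M1 [lu [hu eu]]] := uv_integral uv Yr.
  by move=> t; rewrite -[G u]scale1r; apply: Gr; rewrite oner_neq0.
have [||M2 [lv [hv ev]]] := @uv_integral v u _ _ Yr; first by rewrite eq_sym.
  by move=> t; rewrite -[G v]scale1r addrC; apply: Gr; rewrite oner_neq0 orbT.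
have {}hv : uvdeg_lt u v M2 lv by move=> m /hv; rewrite uvdegC.
exists (M1 + M2)%N, (lu * 'X_u ^+ M2), (lv * 'X_v ^+ M1); split.
- by apply: uvdeg_ltM => //; apply: deg_leU.
- by rewrite addnC; apply: uvdeg_ltM => //; apply: deg_leU.
- by move=> w /eu E; rewrite exprD E mevalM rmorphXn /= mevalXU.
by move=> w /ev E; rewrite addnC exprD E mevalM rmorphXn /= mevalXU.
Qed.

End Pencil.

(** * From chains of irreducible sets to the codimension bound *)

Lemma zariski_closed_ext (K : fieldType) d (Z : ('I_d -> K) -> Prop) (w w' : 'I_d -> K) :
  zariski_closed Z -> w =1 w' -> Z w -> Z w'.
Proof. by move=> [S ZS] ww' /ZS h; apply/ZS => p /h; rewrite (meval_eq _ ww'). Qed.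

(** [Z] is the union of its intersections with the zero sets of [p] and of [q]. *)
Lemma zariski_irreducible_prime (K : fieldType) d (Z : ('I_d -> K) -> Prop) (p q : {mpoly K[d]}) :
  zariski_irreducible Z -> (forall w, Z w -> (p * q).@[w] = 0) ->
  (forall w, Z w -> p.@[w] = 0) \/ (forall w, Z w -> q.@[w] = 0).
Proof.
move=> [[S ZS] [_ irr]] pq.
have closedI (f : {mpoly K[d]}) : zariski_closed (fun w => Z w /\ f.@[w] = 0).
  exists (fun g => S g \/ g = f) => w; split.
    by move=> [/ZS h fw] g [/h|->].
  by move=> h; split; [apply/ZS => g Sg; apply: h; left | apply: h; right].
case: (irr _ _ (closedI p) (closedI q)) => [w | h | h].
- split=> [Zw|]; last by case=> [[]|[]].
  by have /eqP := pq _ Zw; rewrite mevalM mulf_eq0 => /orP[] /eqP ?; [left | right].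
- by left=> w /h[].
by right=> w /h[].
Qed.

Lemma strict_subset_separated (K : fieldType) d (Z1 Z2 : ('I_d -> K) -> Prop) :
  zariski_closed Z1 -> strict_subset Z1 Z2 ->
  exists f : {mpoly K[d]}, (forall w, Z1 w -> f.@[w] = 0) /\ ~ (forall w, Z2 w -> f.@[w] = 0).
Proof.
move=> [S ZS] [_ [x [Z2x nZ1x]]].
have [f nf] : exists f, ~ (S f -> f.@[x] = 0).
  by apply: not_all_ex_not => h; apply/nZ1x/ZS.
have [Sf fx] := imply_to_and _ _ nf.
by exists f; split=> [w /ZS|]; [apply | move=> h; apply/fx/h].
Qed.

(** A linear change of coordinates moves the plane of the rows of [C] to that of the first two
    coordinates, where [uv_integral2] and [chain_length_bound] apply. *)
Lemma codim_ge2_of_rank_drop (K : closedFieldType) (d D r : nat)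
    (G : 'I_d -> 'M[K]_D) (X : ('I_d -> K) -> Prop) (C : 'M[K]_(2, d)) :
  (forall x, X x -> (\rank (lin_mx_at G x) < r)%N) ->
  (forall a : 'rV_2, a != 0 -> (r <= \rank (lin_mx_at G (fun i => (a *m C) 0 i))%R)%N) ->
  codim_ge 2 X.
Proof.
move=> Xr Cr m Z irr strict ZX.
have r0 : (0 < r)%N.
  have [_ [[x Zx] _]] := irr m (leqnn m).
  exact: leq_ltn_trans (Xr _ (ZX _ Zx)).
(* A relation between the rows of [C] would give the zero form rank at least [r > 0]. *)
have Cfree : row_free C.
  rewrite -kermx_eq0; apply: contraLR r0 => /rowV0Pn[a /sub_kermxP aC a0].
  rewrite -leqNgt (leq_trans (Cr _ a0)) // aC /lin_mx_at big1 ?mxrank0 // => i _.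
  by rewrite mxE scale0r.
have d2 : (2 <= d)%N by rewrite -(eqP Cfree) rank_leq_col.
(* The first two rows of [A] span the rows of [C]. *)
pose A := row_ebase C; have Au : A \in unitmx by apply: row_ebase_unit.
pose u := Ordinal (leq_trans (isT : 0 < 2)%N d2); pose v := Ordinal d2.
pose lin (A : 'M[K]_d) (w : 'I_d -> K) j := \sum_i w i * A i j.
have linK w j : lin A (lin (invmx A) w) j = w j.
  have /rowP/(_ j) := mulmxKV Au (\row_i w i); rewrite !mxE => <-.
  by apply: eq_bigr => i _; rewrite mxE; congr (_ * _); apply: eq_bigr => k _; rewrite mxE.
have linK' w j : lin (invmx A) (lin A w) j = w j.
  have /rowP/(_ j) := mulmxK Au (\row_i w i); rewrite !mxE => <-.
  by apply: eq_bigr => i _; rewrite mxE; congr (_ * _); apply: eq_bigr => k _; rewrite mxE.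
pose sub (A : 'M[K]_d) (p : {mpoly K[d]}) := p \mPo [tuple \sum_i A i j *: 'X_i | j < d].
have subE (B : 'M[K]_d) p w : (sub B p).@[w] = p.@[lin B w].
  rewrite comp_mpoly_meval; apply: meval_eq => j.
  rewrite tnth_map tnth_ord_tuple raddf_sum; apply: eq_bigr => i _ /=.
  by rewrite mevalZ mevalXU mulrC.
pose G' l := lin_mx_at G (fun j => A l j).
have G'E w : lin_mx_at G' w = lin_mx_at G (lin A w).
  rewrite /lin_mx_at; under eq_bigr do rewrite scaler_sumr.
  rewrite exchange_big; apply: eq_bigr => j _ /=.
  by rewrite scaler_suml; apply: eq_bigr => i _; rewrite scalerA.
have uv : u != v by [].
pose Y w := X (lin A w).
have [w Yw||M [lu [lv [hu hv eu ev]]]] := @uv_integral2 K d D r G' u v Y uv.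
- by rewrite G'E; apply: Xr.
- move=> s t st.
  (* The combination of the rows of [C] that equals [s], [t] times the first two rows of [A]. *)
  pose a := \row_(i < 2) (if i == 0 then s else t) *m invmx (col_ebase C).
  have a0 : a != 0.
    apply: contraTneq st => a0.
    have := mulmxKV (col_ebase_unit C) (\row_(i < 2) (if i == 0 then s else t)).
    rewrite -/a a0 mul0mx => /rowP E; rewrite negb_or !negbK.
    by have := E 0; have := E 1; rewrite !mxE /= => <- <-; rewrite eqxx.
  have := Cr _ a0; congr (_ <= \rank _)%N.
  rewrite /G' /lin_mx_at !scaler_sumr -big_split; apply: eq_bigr => j _ /=.
  rewrite !scalerA -scalerDl; congr (_ *: _).
  rewrite /a -{2}(mulmx_ebase C) -!mulmxA mulKmx ?col_ebase_unit //.
  rewrite (eqP Cfree) -/A.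
  have pidA (i : 'I_2) (l : 'I_d) : i = l :> nat -> (pid_mx 2 *m A) i j = A l j.
    move=> il; rewrite mxE (bigD1 l) //= big1 ?addr0 => [|k kl].
      by rewrite mxE il eqxx -il ltn_ord mul1r.
    by rewrite mxE il eq_sym (negPf (kl : val k != val l)) mul0r.
  rewrite [LHS]mxE !big_ord_recl big_ord0 addr0 ![(\row__ _) _ _]mxE.
  by rewrite (pidA _ u) // (pidA _ v).
have [f fP] : exists f : 'I_m -> {mpoly K[d]}, forall i : 'I_m,
    (forall w, Z i w -> (f i).@[w] = 0) /\ ~ (forall w, Z i.+1 w -> (f i).@[w] = 0).
  apply: (fin_all_exists (P := fun (i : 'I_m) f =>
    (forall w, Z i w -> f.@[w] = 0) /\ ~ (forall w, Z i.+1 w -> f.@[w] = 0))) => i.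
  by apply: strict_subset_separated; [apply: (irr i (ltnW _)).1 | apply: strict].
(* Index shift: the function separating [Z i] from [Z i.+1], in the new coordinates, is [F i.+1].
   Indices past the chain get 0. *)
pose F k := if insub k.-1 is Some i then sub A (f i) else 0.
have FE i (im : (i < m)%N) : F i.+1 = sub A (f (Ordinal im)).
  by rewrite /F /= insubT.
apply: (chain_length_bound (Z := fun i w => Z i (lin A w)) (f := F) uv hu hv eu ev).
- have [_ [[x Zx] _]] := irr 0%N (leq0n m); exists (lin (invmx A) x).
  exact: (zariski_closed_ext (irr 0%N (leq0n m)).1 (fun j => esym (linK x j))).
- move=> i im p q pq.
  have Zlin x : Z i x -> Z i (lin A (lin (invmx A) x)).
    exact: (zariski_closed_ext (irr i im).1 (fun j => esym (linK x j))).
  have [x Zx|h|h] := @zariski_irreducible_prime _ _ _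
      (sub (invmx A) p) (sub (invmx A) q) (irr i im).
  + by rewrite mevalM !subE -mevalM pq //; apply: Zlin.
  + by left=> w /h; rewrite subE (meval_eq _ (linK' w)).
  by right=> w /h; rewrite subE (meval_eq _ (linK' w)).
- by move=> i im w; apply: (strict i im).1.
- by move=> i im w Zw; rewrite FE subE; apply: (fP _).1.
- move=> i im h; apply: (fP (Ordinal im)).2 => x Zx.
  rewrite -(meval_eq _ (linK x)) -subE -FE; apply: h.
  exact: (zariski_closed_ext (irr i.+1 im).1 (fun j => esym (linK x j))).
by move=> w; apply: ZX.
Qed.

(** * Degenerations of centralisers *)

(** Take a root of [X * \prod (X - b) + 1]; the factor [X] keeps the degree positive for empty
    [s]. *)
Lemma closed_field_avoid (K : closedFieldType) (s : seq K) : exists a, a \notin s.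
Proof.
pose p : {poly K} := 'X * \prod_(b <- s) ('X - b%:P) + 1.
have sp : size p = (size s).+2.
  have p0 : \prod_(b <- s) ('X - b%:P) != 0 :> {poly K}.
    by rewrite -size_poly_eq0 size_prod_XsubC.
  by rewrite size_polyDl mulrC size_mulX // size_prod_XsubC ?size_poly1.
have [a ra] : exists a, root p a by apply: closed_rootP; rewrite sp.
exists a; apply: contraTN ra; rewrite -root_prod_XsubC rootE => /eqP sa.
by rewrite rootE hornerD hornerC hornerM sa mulr0 add0r oner_eq0.
Qed.

(** Each new value avoids 0, the earlier values and their opposites. Distinct squares serve twice:
    in a Vandermonde determinant, and for diagonal entries known only up to sign. *)
Lemma closed_field_squares (K : closedFieldType) m :
  exists a : nat -> K, (forall i, (i < m)%N -> a i != 0) /\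
    forall i j, (i < m)%N -> (j < m)%N -> a i ^+ 2 = a j ^+ 2 -> i = j.
Proof.
elim: m => [|m [a [a0 ainj]]]; first by exists (fun=> 0).
pose s := map a (iota 0 m); have [b] := closed_field_avoid (0 :: s ++ map -%R s).
rewrite inE mem_cat !negb_or => /and3P[b0 bs bNs].
exists (fun i => if i == m then b else a i); split.
  by move=> i; rewrite ltnS leq_eqVlt; case: eqP => //= _; apply: a0.
have ba i : (i < m)%N -> b ^+ 2 = a i ^+ 2 -> False.
  have ai : (i < m)%N -> a i \in s by move=> im; apply: map_f; rewrite mem_iota.
  move=> im /eqP; rewrite eqf_sqr => /orP[] /eqP E.
    by case/negP: bs; rewrite E ai.
  by case/negP: bNs; rewrite E map_f // ai.
move=> i j; rewrite !ltnS leq_eqVlt [(j <= m)%N]leq_eqVlt.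
case: eqP => [->|_] /=; case: eqP => [->|_] //=.
- by move=> _ /ba h /h.
- by move=> /ba h _ /esym /h.
exact: ainj.
Qed.

(* Saturation of [C] lets one divide a relation between the rows at [0] by ['X];
   each such step lowers the degree of the minor [\det (y *m S)]. *)
Lemma specialize_row_free (K : fieldType) n m (C : 'rV[{poly K}]_m -> Prop)
    (y : 'M[{poly K}]_(n, m)) (S : 'M[{poly K}]_(m, n)) :
  (forall a : 'rV_n, forall y' : 'M_(n, m), (forall i, C (row i y')) -> C (a *m y')) ->
  (forall r, C ('X *: r) -> C r) ->
  (forall i, C (row i y)) -> \det (y *m S) != 0 ->
  exists2 y' : 'M_(n, m), row_free (map_mx (horner_eval 0) y') & forall i, C (row i y').
Proof.
move=> Clin Csat; have [k] := ubnP (size (\det (y *m S))).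
elim: k y => // k IHk y yk Cy y0.
have [fy|] := boolP (row_free (map_mx (horner_eval 0) y)); first by exists y.
rewrite -kermx_eq0 => /rowV0Pn[a /sub_kermxP ay /rV0Pn[i0 ai0]].
pose ap := map_mx (polyC : K -> {poly K}) a.
pose r := map_mx (fun p => p %/ 'X) (ap *m y).
have rE : 'X *: r = ap *m y.
  apply/rowP => j; rewrite !mxE mulrC divpK //.
  rewrite -['X]subr0 -[X in _ - X]polyC0 dvdp_XsubCl rootE.
  have /rowP/(_ j) := ay; rewrite !mxE => E.
  rewrite horner_sum -[X in _ == X]E; apply/eqP; apply: eq_bigr => i _.
  by rewrite !mxE hornerM hornerC.
pose y' := \matrix_i (if i == i0 then r else row i y).
have Cy' i : C (row i y').
  by rewrite rowK; case: eqP => // _; apply: Csat; rewrite rE; apply: Clin.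
pose P := \matrix_i (if i == i0 then a else delta_mx 0 i).
have Pu : P \in unitmx.
  rewrite -row_free_unit -kermx_eq0; apply/rowV0P => b /sub_kermxP /rowP bP.
  have bi0 : b 0 i0 = 0.
    have := bP i0; rewrite !mxE (bigD1 i0) //= big1 ?addr0 => [|i ii0].
      by rewrite mxE eqxx => /eqP; rewrite mulf_eq0 (negPf ai0) orbF => /eqP.
    by rewrite !mxE (negPf ii0) mxE eqxx /= eq_sym (negPf ii0) mulr0.
  apply/rowP => i; rewrite mxE; have [->//|ii0] := eqVneq i i0.
  have := bP i; rewrite !mxE (bigD1 i) //= big1 ?addr0 => [|j ji].
    by rewrite mxE (negPf ii0) mxE !eqxx mulr1.
  rewrite mxE; case: eqP => [->|_]; first by rewrite bi0 mul0r.
  by rewrite mxE eqxx /= eq_sym (negPf ji) mulr0.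
(* From [E *m y' = P *m y], with [P] constant and invertible, passing to [y'] divides the minor by
   ['X] up to a nonzero constant. *)
pose E := diag_mx (\row_i (if i == i0 then 'X else 1 : {poly K})).
have EP : E *m y' = map_mx polyC P *m y.
  apply/row_matrixP => i; rewrite !row_mul row_diag_mx -scalemxAl -rowE rowK mxE.
  rewrite -map_row rowK; case: eqP => _; first by rewrite rE.
  by rewrite scale1r map_delta_mx -rowE.
have dE : \det E = 'X.
  rewrite det_diag (bigD1 i0) //= mxE eqxx big1 ?mulr1 // => i ii0.
  by rewrite mxE (negPf ii0).
have detE : 'X * \det (y' *m S) = (\det P)%:P * \det (y *m S).
  by rewrite -dE -det_mulmx mulmxA EP -mulmxA det_mulmx det_map_mx.
have P0 : \det P != 0 by rewrite -unitfE -unitmxE.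
have y'0 : \det (y' *m S) != 0.
  apply: contraNneq y0 => E0; move/eqP: detE.
  by rewrite E0 mulr0 eq_sym mulf_eq0 polyC_eq0 (negPf P0).
apply: (IHk y') => //; rewrite -ltnS (leq_trans _ yk) // ltnS.
have := congr1 (fun p : {poly K} => size p) detE.
by rewrite mulrC size_mulX // mul_polyC size_scale // => ->.
Qed.

Lemma coefp0_mulmx (R : nzRingType) m n p (A : 'M[{poly R}]_(m, n)) (B : 'M_(n, p)) :
  map_mx (coefp 0) (A *m B) = map_mx (coefp 0) A *m map_mx (coefp 0) B.
Proof.
apply/matrixP => i j; rewrite !mxE /= coef_sum; apply: eq_bigr => k _.
by rewrite !mxE coef0M.
Qed.

Lemma coefp1_mulmx (R : nzRingType) m n p (A : 'M[{poly R}]_(m, n)) (B : 'M_(n, p)) :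
  map_mx (coefp 1) (A *m B) =
  map_mx (coefp 0) A *m map_mx (coefp 1) B + map_mx (coefp 1) A *m map_mx (coefp 0) B.
Proof.
apply/matrixP => i j; rewrite !mxE /= coef_sum -big_split; apply: eq_bigr => k _ /=.
by rewrite !mxE coefM big_ord_recl big_ord1 /= subn0.
Qed.

Lemma scalerX_inj (R : idomainType) m n : injective (fun A : 'M[{poly R}]_(m, n) => 'X *: A).
Proof.
move=> A B /matrixP AB; apply/matrixP => i j; have := AB i j; rewrite !mxE.
by apply: mulfI; rewrite polyX_eq0.
Qed.

Lemma map_mx_exp (R S : comNzRingType) (f : {rmorphism R -> S}) n (A : 'M[R]_n) k :
  map_mx f (A ^+ k) = map_mx f A ^+ k.
Proof.
elim: k => [|k IHk]; first by rewrite !expr0 -[1]/(1%:M : 'M_n) map_mx1.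
by rewrite !exprS -!mulmxE map_mxM IHk.
Qed.

Lemma diag_mx_exp (R : comNzRingType) n (v : 'rV[R]_n) k :
  diag_mx v ^+ k = diag_mx (\row_i v 0 i ^+ k).
Proof.
elim: k => [|k IHk].
  rewrite expr0 -[1]/(1%:M : 'M_n) -diag_const_mx; congr diag_mx.
  by apply/rowP => i; rewrite !mxE expr0.
rewrite exprS -mulmxE IHk mulmx_diag; congr diag_mx.
by apply/rowP => i; rewrite !mxE exprS.
Qed.

(** * Symplectic and self-adjoint matrices *)

Section SympGrading.
Context (R : comNzRingType) (N : nat).
Implicit Types (J X Y : 'M[R]_N).

(* [symp_sign J 1]: the symplectic Lie algebra; [symp_sign J 0]: its complement of
   self-adjoint matrices. *)
Definition symp_sign J (b : nat) X := X *m J = (-1) ^+ b *: (J *m X^T).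

Lemma symp_signD J b X Y : symp_sign J b X -> symp_sign J b Y -> symp_sign J b (X + Y).
Proof. by rewrite /symp_sign => XJ YJ; rewrite mulmxDl XJ YJ linearD /= mulmxDr scalerDr. Qed.

Lemma symp_signZ J b c X : symp_sign J b X -> symp_sign J b (c *: X).
Proof.
rewrite /symp_sign => XJ; rewrite -scalemxAl XJ [(c *: X)^T]linearZ /= -scalemxAr !scalerA.
by rewrite mulrC.
Qed.

Lemma symp_signB J b X Y : symp_sign J b X -> symp_sign J b Y -> symp_sign J b (X - Y).
Proof. by move=> hX hY; rewrite -scaleN1r; apply/symp_signD/symp_signZ. Qed.

Lemma symp_sign_exp J X k : symp_sign J 1 X -> symp_sign J k (X ^+ k).
Proof.
rewrite /symp_sign expr1 scaleN1r => XJ; elim: k => [|k IHk].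
  by rewrite !expr0 -[1]/(1%:M : 'M_N) trmx1 mulmx1 mul1mx scale1r.
rewrite {1}exprSr [X ^+ k.+1]exprS -!mulmxE -mulmxA XJ mulmxN mulmxA IHk trmx_mul.
by rewrite exprS mulN1r scaleNr -scalemxAl mulmxA.
Qed.

End SympGrading.

Section Vinberg.
Context (K : closedFieldType) (n : nat).
Local Notation N := (n + n)%N.
Local Notation J := (symp_J K n).
Context (e x : 'M[K]_N) (he : symp_sign J 1 e) (hx : symp_sign J 1 x).

Lemma symp_sign_diag (a : 'rV[K]_n) : symp_sign J 1 (diag_mx (row_mx a (- a))).
Proof.
rewrite /symp_sign tr_diag_mx diag_mx_row /symp_J !mulmx_block !mul0mx !mulmx0.
rewrite !add0r !addr0 !mulmx1 !mul1mx mulmxN mulNmx mul1mx mulmx1 expr1 scaleN1r opp_block_mx !oppr0.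
by congr block_mx; apply/matrixP => i j; rewrite !mxE mulNrn ?opprK.
Qed.

(* The rows of [Y] are limits at [t = 0] of combinations of powers of [e + t x + O(t^2)],
   where the remainder is chosen so that this matrix is diagonal and regular at [t = 1]. *)
Lemma stabiliser_lower_bound (b : bool) :
  exists2 Y : 'M[K]_(n, N * N), row_free Y &
    forall i, [/\ symp_sign J b (vec_mx (row i Y)),
      vec_mx (row i Y) *m e = e *m vec_mx (row i Y) &
      forall z, z *m e = e *m z -> \tr (x *m lie_br (vec_mx (row i Y)) z) = 0].
Proof.
have [a [a0 ainj]] := closed_field_squares K n.
pose av := \row_(i < n) a i; pose X0 := diag_mx (row_mx av (- av)).
pose cst := map_mx (polyC : K -> {poly K}) : 'M[K]_N -> 'M[{poly K}]_N.
pose Z := cst e + 'X *: cst x + 'X^2 *: cst (X0 - e - x).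
pose Jp : 'M[{poly K}]_N := cst J.
have cstJ X : symp_sign J 1 X -> symp_sign Jp 1 (cst X).
  rewrite /symp_sign /Jp /cst => XJ.
  by rewrite -map_mxM XJ /= !expr1 !scaleN1r map_mxN map_mxM map_trmx.
have ZJ : symp_sign Jp 1 Z.
  apply: symp_signD; first by apply: symp_signD; [|apply: symp_signZ]; apply: cstJ.
  apply/symp_signZ/cstJ/symp_signB => //; apply: symp_signB => //; exact: symp_sign_diag.
(* The matrices of sign [b] commuting with [Z]: a saturated module, as [specialize_row_free]
   demands. *)
pose C (r : 'rV[{poly K}]_(N * N)) :=
  symp_sign Jp b (vec_mx r) /\ vec_mx r *m Z = Z *m vec_mx r.
pose y := \matrix_(k < n) mxvec (Z ^+ (k.*2 + b)).
(* [S] reads the first [n] diagonal entries. At [t = 1] the minor is the Vandermonde determinant of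
   the [a i ^+ 2] times the product of the [a i ^+ b]. *)
pose S : 'M[{poly K}]_(N * N, n) :=
  \matrix_(k, i) (k == mxvec_index (lshift n i) (lshift n i))%:R.
have Cy i : C (row i y).
  rewrite /C rowK mxvecK; split; last by rewrite mulmxE -exprS -exprSr.
  have := symp_sign_exp (i.*2 + b) ZJ; rewrite /symp_sign => ->.
  by rewrite exprD -mul2n exprM sqrrN expr1n expr1n mul1r.
have Z1 : map_mx (horner_eval 1) Z = X0.
  rewrite /Z !map_mxD !map_mxZ /= /horner_eval hornerX hornerXn expr1n !scale1r.
  by rewrite /cst -!map_mx_comp !map_mx_id => [|c|c|c] /=;
    rewrite ?hornerC // -[X0 - e - x]addrA -opprD [LHS]addrC subrK.
have CD r s : C r -> C s -> C (r + s).
  move=> [rJ rZ] [sJ sZ]; rewrite /C linearD /=.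
  by split; [apply: symp_signD | rewrite mulmxDl rZ sZ -mulmxDr].
have CZ c r : C r -> C (c *: r).
  move=> [rJ rZ]; rewrite /C linearZ /=.
  by split; [apply: symp_signZ | rewrite -scalemxAl -scalemxAr rZ].
have Clin (c : 'rV_n) (y' : 'M_(n, N * N)) : (forall i, C (row i y')) -> C (c *m y').
  move=> Cy'; rewrite mulmx_sum_row; apply: big_ind => [||i _]; last exact: CZ.
    by rewrite /C linear0 /symp_sign !mul0mx trmx0 !mulmx0 scaler0.
  exact: CD.
have Csat r : C ('X *: r) -> C r.
  rewrite /C linearZ /= /symp_sign linearZ /= -!scalemxAl -!scalemxAr => -[rJ /scalerX_inj ->].
  by split=> //; apply: scalerX_inj; rewrite rJ !scalerA mulrC.
have detS : \det (y *m S) != 0.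
  suff : horner_eval 1 (\det (y *m S)) != 0.
    by apply: contra_neq => ->; rewrite /horner_eval horner0.
  rewrite -det_map_mx.
  rewrite (_ : map_mx _ _ = Vandermonde n (\row_i a i ^+ 2) *m diag_mx (\row_i a i ^+ b)).
    rewrite det_mulmx det_Vandermonde det_diag mulf_neq0 //; last first.
      by apply/prodf_neq0 => i _; rewrite mxE expf_neq0 ?a0.
    apply/prodf_neq0 => i _; apply/prodf_neq0 => j ij; rewrite !mxE subr_eq0.
    by apply: contraTneq ij => /ainj -> //; rewrite ltnn.
  have ySE k i : (y *m S) k i = (Z ^+ (k.*2 + b)) (lshift n i) (lshift n i).
    rewrite mxE (bigD1 (mxvec_index (lshift n i) (lshift n i))) //= big1 ?addr0 => [|l lP].
      by rewrite !mxE eqxx mulr1 mxvecE.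
    by rewrite [S _ _]mxE (negPf lP) mulr0.
  apply/matrixP => k i; rewrite mul_mx_diag [LHS]mxE ySE.
  transitivity (map_mx (horner_eval 1) (Z ^+ (k.*2 + b)) (lshift n i) (lshift n i)).
    by rewrite [RHS]mxE.
  by rewrite map_mx_exp Z1 diag_mx_exp [LHS]mxE eqxx mulr1n [LHS]mxE row_mxEl !mxE
    -mul2n exprD exprM.
have [y' y'free Cy'] := specialize_row_free Clin Csat Cy detS.
exists (map_mx (horner_eval 0) y') => // i.
have [yJ yZ] := Cy' i.
rewrite -map_row -map_vec_mx; move: (vec_mx (row i y')) yJ yZ => Y YJ YZ.
have ev0 m p (A : 'M[{poly K}]_(m, p)) : map_mx (horner_eval 0) A = map_mx (coefp 0) A.
  by apply/matrixP => k l; rewrite !mxE /= /horner_eval horner_coef0.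
have Z0 : map_mx (coefp 0) Z = e.
  by apply/matrixP => k l; rewrite !mxE /= !coefD coefXM coefXnM coefC /= !addr0.
have Zx : map_mx (coefp 1) Z = x.
  by apply/matrixP => k l; rewrite !mxE /= !coefD coefXM coefXnM !coefC /= addr0 add0r.
have J0 : map_mx (coefp 0) Jp = J.
  by apply/matrixP => k l; rewrite !mxE /= coefC.
rewrite ev0; split.
- have := congr1 (map_mx (coefp 0)) YJ; rewrite /symp_sign coefp0_mulmx J0 => ->.
  rewrite map_trmx -[in RHS]J0 -coefp0_mulmx.
  have -> : (-1) ^+ b = ((-1) ^+ b)%:P :> {poly K} by rewrite rmorphXn rmorphN1.
  by apply/matrixP => k l; rewrite !mxE /= coefCM.
- by have := congr1 (map_mx (coefp 0)) YZ; rewrite !coefp0_mulmx Z0.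
(* The coefficient of [t] in the commutation relation gives [[x, Y0] = [Y1, e]], and the trace of
   [[Y1, e] z] vanishes when [z] commutes with [e]. *)
move=> z ze; have := congr1 (map_mx (coefp 1)) YZ; rewrite !coefp1_mulmx Z0 Zx.
move: (map_mx (coefp 0) Y) (map_mx (coefp 1) Y) => Y0 Y1 YE.
rewrite /lie_br mulmxBr linearB /= !mulmxA.
rewrite [\tr (x *m z *m Y0)]mxtrace_mulC mulmxA -linearB /= -mulmxBl.
have -> : x *m Y0 - Y0 *m x = Y1 *m e - e *m Y1.
  by apply/eqP; rewrite subr_eq addrAC eq_sym subr_eq addrC YE addrC.
by rewrite mulmxBl linearB /= -!mulmxA [\tr (e *m _)]mxtrace_mulC -mulmxA ze subrr.
Qed.

End Vinberg.

(** * Stabilisers in a Jordan basis *)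

Section StabiliserEquations.
Context (K : fieldType) (k : nat) (D : nat -> nat) (x : nat -> nat -> K).
Context (f : nat -> nat -> nat -> K).
(** Applied with [f] equal to [jordan_coef]; the equation for [l], [m], [u] tests the stabiliser
    condition against [commutant_elt l m u]. *)
Hypothesis stab_eq : forall l m u, (l < k)%N -> (m < k)%N -> (D m <= u + D l)%N ->
  \sum_(j < k) x l j * f j m u = \sum_(i < k) x i m * f l i (u + D l - D m).

(* The entries [f l m] with [m <= l.+1] vanish column after column; the others vanish by
   induction on [m - l] and, for a given [m - l], by descending induction on [l]. *)
Lemma hessenberg_stab_trivial :
  (forall i j, (i <= j)%N -> (j < k)%N -> (D j <= D i)%N) ->
  (forall i j, (i < k)%N -> (j.+1 < i)%N -> x i j = 0) ->
  (forall j, (j.+1 < k)%N -> x j.+1 j != 0) ->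
  (forall j s, (j < k)%N -> f j 0 s = 0) ->
  forall l m q, (l < k)%N -> (m < k)%N -> f l m q = 0.
Proof.
move=> Ddec xhess xsub f0.
have lower M l m q : (m <= M)%N -> (m <= l.+1)%N -> (l < k)%N -> (m < k)%N -> f l m q = 0.
  elim: M l m q => [|M IHM] l m q; first by case: m => // _ _ lk _; apply: f0.
  rewrite leq_eqVlt => /orP[/eqP -> | /IHM h]; last exact: h.
  rewrite ltnS => Ml lk Mk.
  have Mk' : (M < k)%N by apply: ltnW.
  (* The shift makes the right side involve [f l _ q], of which only the subdiagonal term [i = M.+1]
     survives. *)
  have := @stab_eq l M (D M - D l + q) lk Mk'.
  have DMl := Ddec _ _ Ml lk; rewrite addnAC subnK // leq_addr addKn => /(_ isT).
  rewrite big1 => [|j _]; last first.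
    have [jl|jl] := ltnP j.+1 l; first by rewrite xhess ?mul0r.
    by rewrite IHM ?mulr0 // (leq_trans Ml).
  rewrite (bigD1 (Ordinal Mk)) //= big1 ?addr0 => [/esym/eqP|i iM]; last first.
    have [Mi|iM'] := ltnP M.+1 i; first by rewrite xhess ?mul0r.
    have iM1 : (i <= M)%N by rewrite -ltnS ltn_neqAle iM' (contra_neq _ iM) // => E; apply: val_inj.
    by rewrite IHM ?mulr0 // (leq_trans iM1) // (leq_trans Ml).
  by rewrite mulf_eq0 (negPf (xsub _ Mk)) /= => /eqP.
have upper r l m q : (m <= l + r.+1)%N -> (l < k)%N -> (m < k)%N -> f l m q = 0.
  elim: r l m q => [|r IHr] l m q.
    by rewrite addn1 => ml lk mk; apply: (lower m).
  have [c] := ubnP (k - m); elim: c l m q => // c IHc l m q kmc.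
  rewrite leq_eqVlt => /orP[/eqP mE | ]; last by rewrite addnS ltnS; apply: IHr.
  move=> lk mk; have l1m : (l.+1 <= m)%N by rewrite mE addnS ltnS leq_addr.
  have l1k := leq_ltn_trans l1m mk.
  (* Row [l.+1] isolates [f l m q] on the left; on the right the term [i = m.+1], which has the same
     [m - l], is left to the inner induction. *)
  have := @stab_eq l.+1 m q l1k mk; rewrite (leq_trans (Ddec _ _ l1m mk) (leq_addl _ _)).
  move=> /(_ isT).
  rewrite (bigD1 (Ordinal lk)) //= big1 ?addr0 => [|j jl]; last first.
    have [jl'|jl'] := ltnP j l; first by rewrite xhess ?mul0r.
    have lj : (l.+1 <= j)%N by rewrite ltn_neqAle jl' (contra_neq _ jl) // => E; apply: val_inj.
    by rewrite IHr ?mulr0 // mE addnS -addSn leq_add2r.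
  rewrite big1 => [/eqP|i _].
    by rewrite mulf_eq0 (negPf (xsub _ l1k)) /= => /eqP.
  have [mi|im] := ltnP m.+1 i; first by rewrite xhess ?mul0r.
  have [im'|mi] := leqP i m; first by rewrite IHr ?mulr0 // addSnnS -mE.
  have {im mi} iE : i = m.+1 :> nat by apply/eqP; rewrite eqn_leq im.
  rewrite IHc ?mulr0 //; last by rewrite iE mE addSn.
  by rewrite iE subnS prednK ?subn_gt0 // -ltnS.
by move=> l m q lk mk; apply: (upper m) => //; rewrite addnS leqW // leq_addl.
Qed.

(** Here [x l l * f l m u = x m m * f l m (u + D l - D m)]. If [D l] and [D m] differ, this relates
    each exponent to a larger one, and beyond [B] all is 0; if they agree, [x l l != x m m] forces
    0. *)
Lemma diagonal_stab_offdiag B :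
  (forall i j, (i < k)%N -> (j < k)%N -> i != j -> x i j = 0) ->
  (forall i, (i < k)%N -> x i i != 0) ->
  (forall i j, (i < k)%N -> (j < k)%N -> i != j -> x i i != x j j) ->
  (forall l m s, (l < k)%N -> (m < k)%N -> (B <= s)%N -> f l m s = 0) ->
  forall l m q, (l < k)%N -> (m < k)%N -> l != m -> f l m q = 0.
Proof.
move=> xdiag xnz xneq fB l m q lk mk lm.
have eqlm u : (D m <= u + D l)%N -> x l l * f l m u = x m m * f l m (u + D l - D m).
  move=> hu; have := stab_eq lk mk hu.
  rewrite (bigD1 (Ordinal lk)) //= big1 ?addr0 => [|j jl]; last first.
    by rewrite xdiag ?mul0r // eq_sym.
  by rewrite (bigD1 (Ordinal mk)) //= big1 ?addr0 // => i im; rewrite xdiag ?mul0r.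
have shift (c c' : K) del : c != 0 -> (0 < del)%N ->
    (forall u, c * f l m u = c' * f l m (u + del)) -> f l m q = 0.
  move=> c0 d0 H; have [n] := ubnP (B - q); elim: n q => // n IHn u un.
  have [Bu|uB] := leqP B u; first exact: fB.
  apply/eqP; have /eqP := H u; rewrite (IHn (u + del)%N) ?mulr0 ?mulf_eq0 ?(negPf c0) //.
  rewrite -ltnS (leq_trans _ un) // ltnS ltn_sub2l //.
  by rewrite -[X in (X < _)%N]addn0 ltn_add2l.
have [Dml|Dlm|Dml] := ltngtP (D m) (D l).
- apply: (@shift (x l l) (x m m) (D l - D m)%N); rewrite ?xnz ?subn_gt0 // => u.
  by rewrite eqlm ?addnBA // ltnW // (leq_trans Dml) // leq_addl.
- apply: (@shift (x m m) (x l l) (D m - D l)%N); rewrite ?xnz ?subn_gt0 // => u.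
  rewrite eqlm; last by rewrite -addnA subnK ?leq_addl // ltnW.
  by rewrite -addnA subnK ?addnK // ltnW.
have := eqlm q; rewrite Dml leq_addl addnK => /(_ isT)/eqP.
by rewrite -subr_eq0 -mulrBl mulf_eq0 subr_eq0 (negPf (xneq _ _ lk mk lm)) => /eqP.
Qed.

End StabiliserEquations.

(** * Jordan systems and their commutants *)

Section JordanSystem.
Context (K : fieldType) (N : nat) (e : 'M[K]_N) (k : nat) (D : nat -> nat).
Context (w : nat -> 'rV[K]_N) (phi : nat -> 'cV[K]_N).
Hypothesis w_phi : forall i l t, (i < k)%N -> (l < k)%N ->
  (w i *m e ^+ t *m phi l) 0 0 = ((i == l) && (t.+1 == D l))%:R.
Hypothesis phiD : forall l, (l < k)%N -> e ^+ D l *m phi l = 0.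
Hypothesis wD : forall i, (i < k)%N -> w i *m e ^+ D i = 0.
Hypothesis separated : forall v : 'rV_N,
  (forall l t, (l < k)%N -> (v *m e ^+ t *m phi l) 0 0 = 0) -> v = 0.
Implicit Types y z : 'M[K]_N.

Lemma commute_exp y t : y *m e = e *m y -> y *m e ^+ t = e ^+ t *m y.
Proof. by move=> ye; rewrite mulmxE; apply: commrX; rewrite /GRing.comm -mulmxE. Qed.

Lemma mulmx_exprD m (u : 'M_(m, N)) s t : u *m e ^+ s *m e ^+ t = u *m e ^+ (s + t).
Proof. by rewrite exprD -mulmxE mulmxA. Qed.

Lemma exp_phi0 l t : (l < k)%N -> (D l <= t)%N -> e ^+ t *m phi l = 0.
Proof.
by move=> lk lt; rewrite -(subnK lt) exprD -mulmxE -mulmxA phiD // mulmx0.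
Qed.

Lemma w_exp0 i t : (i < k)%N -> (D i <= t)%N -> w i *m e ^+ t = 0.
Proof.
by move=> ik it; rewrite -(subnKC it) exprD -mulmxE mulmxA wD // mul0mx.
Qed.

Lemma mx11_mul m n (u : 'rV[K]_m) (a : 'cV_m) (b : 'rV_n) :
  u *m (a *m b) = (u *m a) 0 0 *: b.
Proof. by rewrite mulmxA {1}[u *m a]mx11_scalar mul_scalar_mx. Qed.

(** The projection to the span of the [w l *m e ^+ s]: the functional [phi l] reads the coefficient
    once [e ^+ (D l - s.+1)] has moved it to the top power. *)
Definition jordan_proj (v : 'rV_N) : 'rV_N :=
  \sum_(l < k) \sum_(s < D l) (v *m e ^+ (D l - s.+1) *m phi l) 0 0 *: (w l *m e ^+ s).

Lemma jordan_residue v j t : (j < k)%N -> ((v - jordan_proj v) *m e ^+ t *m phi j) 0 0 = 0.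
Proof.
move=> jk.
rewrite !mulmxBl mxE [X in _ + X]mxE; apply/eqP; rewrite subr_eq0; apply/eqP.
rewrite !mulmx_suml summxE (bigD1 (Ordinal jk)) //= [X in _ + X]big1 ?addr0 => [|l lj]; last first.
  rewrite !mulmx_suml summxE big1 // => s _.
  rewrite -!scalemxAl mulmx_exprD.
  by rewrite mxE w_phi // (negPf (lj : val l != val (Ordinal jk))) mulr0.
rewrite !mulmx_suml summxE.
have termE s : ((v *m e ^+ (D j - s.+1) *m phi j) 0 0 *: (w j *m e ^+ s) *m e ^+ t *m phi j) 0 0
    = (v *m e ^+ (D j - s.+1) *m phi j) 0 0 * ((s + t).+1 == D j)%:R.
  by rewrite -!scalemxAl mxE mulmx_exprD w_phi // eqxx.
under eq_bigr do rewrite termE.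
have [tD|Dt] := ltnP t (D j); last first.
  rewrite -mulmxA exp_phi0 // mulmx0 mxE big1 // => s _.
  by rewrite gtn_eqF ?mulr0 // ltnS (leq_trans Dt) // leq_addl.
(* Only the summand [s = D j - t.+1] is seen by [phi j] after [e ^+ t]. *)
have sD : (D j - t.+1 < D j)%N by rewrite ltn_subrL (leq_ltn_trans _ tD).
rewrite (bigD1 (Ordinal sD)) //= big1 ?addr0 => [|s sE]; last first.
  rewrite (_ : _ == _ = false) ?mulr0 //; apply: contraNF sE => /eqP E.
  by apply/eqP/val_inj; rewrite /= -(addnK t.+1 s) addnS E.
by rewrite -addnS subnK // eqxx mulr1 subnSK // subKn // ltnW.
Qed.

Lemma jordan_expand v : v = jordan_proj v.
Proof.
apply/eqP; rewrite -subr_eq0; apply/eqP; apply: separated => j t jk.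
exact: jordan_residue.
Qed.

Lemma jordan_rank : (forall l, (l < k)%N -> (0 < D l)%N) -> (k <= N)%N.
Proof.
move=> D0; pose W := \matrix_(i < k) w i.
pose Phi := \matrix_(i < N, l < k) (e ^+ (D l).-1 *m phi l) i 0.
have WPhi : W *m Phi = 1%:M.
  apply/matrixP => i l; rewrite [RHS]mxE.
  transitivity ((w i *m e ^+ (D l).-1 *m phi l) 0 0).
    rewrite -mulmxA !mxE; apply: eq_bigr => q _; rewrite [W _ _]mxE [Phi _ _]mxE.
    by rewrite [RHS]mulrC mulrC; congr (_ * _); rewrite mxE.
  by rewrite w_phi // prednK ?D0 // eqxx andbT.
by rewrite -(mxrank1 K k) -WPhi (leq_trans (mxrankM_maxl _ _)) // rank_leq_col.
Qed.

Lemma commutant_eq0 y : y *m e = e *m y -> (forall i, (i < k)%N -> w i *m y = 0) -> y = 0.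
Proof.
move=> ye wy; apply/row_matrixP => i; rewrite row0 rowE.
rewrite [delta_mx 0 i]jordan_expand !mulmx_suml big1 // => l _.
rewrite mulmx_suml big1 // => s _.
by rewrite -scalemxAl -[w l *m _ *m y]mulmxA -commute_exp // mulmxA wy // mul0mx scaler0.
Qed.

(** For [D m <= u + D l], the element of the commutant sending [w l] to [w m *m e ^+ u] and the
    other generators to 0. *)
Definition commutant_elt l m u : 'M[K]_N :=
  \sum_(s < D l) e ^+ (D l - s.+1) *m (phi l *m (w m *m e ^+ (u + s))).

(** Both products sum the same terms [g s] over ranges shifted by one, and the boundary terms
    vanish: [s = 0] by [phiD], [s = D l] by the bound on [D m]. *)
Lemma commutant_elt_comm l m u : (l < k)%N -> (m < k)%N -> (D m <= u + D l)%N ->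
  commutant_elt l m u *m e = e *m commutant_elt l m u.
Proof.
move=> lk mk hu; pose g s := e ^+ (D l - s) *m (phi l *m (w m *m e ^+ (u + s))).
transitivity (\sum_(s < D l) g s.+1).
  rewrite mulmx_suml; apply: eq_bigr => s _.
  rewrite /g; have -> : e ^+ (u + s.+1) = e ^+ (u + s) *m e by rewrite addnS exprSr -mulmxE.
  by rewrite !mulmxA.
transitivity (\sum_(s < D l) g s).
  have : \sum_(s < (D l).+1) g s = \sum_(s < (D l).+1) g s by [].
  rewrite {1}big_ord_recl big_ord_recr /= {1}/g subn0 mulmxA phiD // mul0mx add0r => ->.
  by rewrite {2}/g w_exp0 // !mulmx0 addr0.
rewrite mulmx_sumr; apply: eq_bigr => s _.
rewrite /g; have -> : e ^+ (D l - s) = e *m e ^+ (D l - s.+1) by rewrite mulmxE -exprS -subSn // subSS.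
by rewrite -!mulmxA.
Qed.

Lemma w_commutant_elt l m u i : (l < k)%N -> (i < k)%N -> (0 < D l)%N ->
  w i *m commutant_elt l m u = (i == l)%:R *: (w m *m e ^+ u).
Proof.
move=> lk ik D0; rewrite mulmx_sumr (bigD1 (Ordinal D0)) //= big1 ?addr0 => [|s s0].
  by rewrite mulmxA mx11_mul w_phi // subn1 prednK // eqxx andbT addn0.
rewrite mulmxA mx11_mul w_phi // -subSn // subSS.
rewrite (_ : (_ == D l) = false) ?andbF ?scale0r //.
by apply: ltn_eqF; rewrite ltn_subrL D0 andbT lt0n.
Qed.

Context (x : nat -> nat -> K).

Definition jordan_form y := \sum_(i < k) \sum_(j < k) x i j * (w i *m y *m phi j) 0 0.

Context (y : 'M[K]_N) (ye : y *m e = e *m y).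
Hypothesis stab : forall z, z *m e = e *m z -> jordan_form (y *m z) = jordan_form (z *m y).
Hypothesis D_gt0 : forall l, (l < k)%N -> (0 < D l)%N.

Definition jordan_coef j m s := (w m *m e ^+ s *m y *m phi j) 0 0.

Lemma jordan_coef0 l i s : (l < k)%N -> (D l <= s)%N -> jordan_coef l i s = 0.
Proof.
move=> lk ls; rewrite /jordan_coef -[w i *m _ *m _]mulmxA -commute_exp // -!mulmxA exp_phi0 //.
by rewrite !mulmx0 mxE.
Qed.

(** For [z] the commutant element, the form at [z y] keeps only row [l] of [x], the form at [y z]
    only column [m]. *)
Lemma jordan_stab_eq l m u : (l < k)%N -> (m < k)%N -> (D m <= u + D l)%N ->
  \sum_(j < k) x l j * jordan_coef j m u =
  \sum_(i < k) x i m * jordan_coef l i (u + D l - D m).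
Proof.
move=> lk mk hu; have := stab (commutant_elt_comm lk mk hu).
rewrite /jordan_form [X in _ = X](bigD1 (Ordinal lk)) //= [X in _ = _ + X]big1; last first.
  move=> i il; rewrite big1 // => j _.
  by rewrite mulmxA w_commutant_elt ?D_gt0 // (negPf (il : val i != val (Ordinal lk))) scale0r !mul0mx mxE mulr0.
rewrite addr0 => E; transitivity (\sum_(j < k) x l j * (w l *m (commutant_elt l m u *m y) *m phi j) 0 0).
  by apply: eq_bigr => j _; rewrite mulmxA w_commutant_elt ?D_gt0 // eqxx scale1r.
rewrite -E; apply: eq_bigr => i _.
rewrite (bigD1 (Ordinal mk)) //= big1 ?addr0 => [|j jm]; last first.
  rewrite mulmxA mulmx_sumr mulmx_suml summxE big1 ?mulr0 // => s _.
  rewrite mulmxA mx11_mul -scalemxAl mxE w_phi // eq_sym.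
  by rewrite (negPf (jm : val j != val (Ordinal mk))) mulr0.
congr (_ * _); rewrite mulmxA mulmx_sumr mulmx_suml summxE.
have termE s : (w i *m y *m (e ^+ (D l - s.+1) *m (phi l *m (w m *m e ^+ (u + s)))) *m phi m) 0 0
  = jordan_coef l i (D l - s.+1) * ((u + s).+1 == D m)%:R.
  rewrite mulmxA mx11_mul -scalemxAl mxE w_phi // eqxx /jordan_coef.
  by rewrite -[w i *m y *m _]mulmxA commute_exp // mulmxA.
under eq_bigr do rewrite termE.
(* For [u >= D m] the exponent on the right is at least [D l], so coefficient and sum both vanish;
   otherwise [s = D m - u.+1] is the only summand. *)
have [uD|Du] := ltnP u (D m); last first.
  rewrite jordan_coef0 //; last by rewrite -addnBAC // leq_addl.
  by rewrite big1 // => s _; rewrite gtn_eqF ?mulr0 // ltnS (leq_trans Du) // leq_addr.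
have sD : (D m - u.+1 < D l)%N by rewrite ltn_subLR // addSn ltnS.
rewrite (bigD1 (Ordinal sD)) //= big1 ?addr0 => [|s sE]; last first.
  rewrite (_ : _ == _ = false) ?mulr0 //; apply: contraNF sE => /eqP Es.
  by apply/eqP/val_inj; rewrite /= -(addKn u.+1 s) addSn Es.
rewrite -addSn subnKC // eqxx mulr1 subnSK // subnBA ?(ltnW uD) //.
by rewrite addnC.
Qed.

Lemma jordan_coefs_eq0 :
  (forall l m q, (l < k)%N -> (m < k)%N -> jordan_coef l m q = 0) -> y = 0.
Proof.
move=> h; apply: commutant_eq0 => // m mk; apply: separated => l t lk.
by rewrite -(h l m t lk mk) /jordan_coef -[w m *m y *m _]mulmxA commute_exp // mulmxA.
Qed.

Lemma hessenberg_regular :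
  (forall i j, (i <= j)%N -> (j < k)%N -> (D j <= D i)%N) ->
  (forall i j, (i < k)%N -> (j.+1 < i)%N -> x i j = 0) ->
  (forall j, (j.+1 < k)%N -> x j.+1 j != 0) ->
  w 0 *m y = 0 -> y = 0.
Proof.
move=> Ddec xh xs w0y; apply/jordan_coefs_eq0/(hessenberg_stab_trivial jordan_stab_eq) => //.
move=> j s jk; rewrite /jordan_coef -[w 0 *m _ *m _]mulmxA -commute_exp //.
by rewrite mulmxA w0y !mul0mx mxE.
Qed.

(** Once the off-diagonal coefficients vanish, [jordan_coef l l q] is the sum of all
    [jordan_coef l i q], which is a coefficient of the image of [\sum_i w i]. *)
Lemma diagonal_regular :
  (forall i j, (i < k)%N -> (j < k)%N -> i != j -> x i j = 0) ->
  (forall i, (i < k)%N -> x i i != 0) ->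
  (forall i j, (i < k)%N -> (j < k)%N -> i != j -> x i i != x j j) ->
  (\sum_(i < k) w i) *m y = 0 -> y = 0.
Proof.
move=> xd xn xneq wy; apply: jordan_coefs_eq0 => l m q lk mk.
pose B := \max_(i < k) D i.
have off := diagonal_stab_offdiag jordan_stab_eq (B := B) xd xn xneq.
have {off}off l' m' s : (l' < k)%N -> (m' < k)%N -> l' != m' -> jordan_coef l' m' s = 0.
  apply: off => l1 m1 s1 l1k _ /(leq_trans _) h; apply: jordan_coef0 => //; apply: h.
  exact: (@leq_bigmax _ (fun i : 'I_k => D i) (Ordinal l1k)).
have [<-{m mk}|] := eqVneq l m; last exact: off.
transitivity (\sum_(i < k) jordan_coef l i q).
  rewrite (bigD1 (Ordinal lk)) //= big1 ?addr0 // => i il; rewrite off //.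
  by rewrite eq_sym.
transitivity (((\sum_(i < k) w i) *m e ^+ q *m y *m phi l) 0 0).
  by rewrite !mulmx_suml summxE.
by rewrite -[_ *m e ^+ q *m _]mulmxA -commute_exp // mulmxA wy !mul0mx mxE.
Qed.

End JordanSystem.

(** * Symplectic Jordan bases *)

Section Form.
Context (K : fieldType) (N : nat) (J e : 'M[K]_N).
Hypothesis K2 : (2%:R : K) != 0.
Hypothesis Jskew : J^T = - J.
Hypothesis Junit : J \in unitmx.
Hypothesis eJ : symp_sign J 1 e.
Implicit Types (u v a b : 'rV[K]_N).

Definition omega u v : K := (u *m J *m v^T) 0 0.

Lemma omegaDl u v z : omega (u + v) z = omega u z + omega v z.
Proof. by rewrite /omega !mulmxDl mxE. Qed.

Lemma omegaDr u v z : omega z (u + v) = omega z u + omega z v.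
Proof. by rewrite /omega linearD /= mulmxDr mxE. Qed.

Lemma omegaZl c u v : omega (c *: u) v = c * omega u v.
Proof. by rewrite /omega -!scalemxAl mxE. Qed.

Lemma omegaZr c u v : omega u (c *: v) = c * omega u v.
Proof. by rewrite /omega linearZ /= -scalemxAr mxE. Qed.

Lemma omega0r u : omega u 0 = 0.
Proof. by rewrite /omega trmx0 mulmx0 mxE. Qed.

Lemma omega_sumr (I : Type) (l : seq I) (P : pred I) u (F : I -> 'rV_N) :
  omega u (\sum_(i <- l | P i) F i) = \sum_(i <- l | P i) omega u (F i).
Proof. by apply: (big_morph (omega u)); [move=> *; apply: omegaDr | apply: omega0r]. Qed.

Lemma omegaC u v : omega u v = - omega v u.
Proof.
rewrite /omega; transitivity ((u *m J *m v^T)^T 0 0); first by rewrite [RHS]mxE.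
by rewrite !trmx_mul trmxK Jskew mulNmx mulmxN mxE mulmxA.
Qed.

Lemma omega_exp u v t : omega (u *m e ^+ t) v = (-1) ^+ t * omega u (v *m e ^+ t).
Proof.
have := symp_sign_exp t eJ; rewrite /symp_sign /omega => E.
by rewrite -[u *m _ *m J]mulmxA E -scalemxAr -scalemxAl mxE trmx_mul !mulmxA.
Qed.

Lemma omega_nondeg u : (forall v, omega u v = 0) -> u = 0.
Proof.
move=> h; apply: (can_inj (mulmxK Junit)); rewrite mul0mx; apply/rowP => i.
rewrite !mxE -[RHS](h (delta_mx 0 i)) /omega trmx_delta -colE.
by rewrite [RHS]mxE [RHS]mxE.
Qed.

Lemma eq_opp0 (c : K) : c = - c -> c = 0.
Proof.
move/eqP; rewrite -subr_eq0 opprK -mulr2n -mulr_natl mulf_eq0 (negPf K2) /=.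
exact: eqP.
Qed.

(** For even [t] the form [omega u (v *m e ^+ t)] is skew-symmetric, and 2 is nonzero. *)
Lemma omega_even u t : ~~ odd t -> omega u (u *m e ^+ t) = 0.
Proof.
move=> te; apply: eq_opp0; rewrite {1}omegaC omega_exp -signr_odd (negPf te).
by rewrite expr0 mul1r.
Qed.

Lemma omega_expC u v s t :
  omega (u *m e ^+ s) (v *m e ^+ t) = (-1) ^+ s * omega u (v *m e ^+ (s + t)).
Proof. by rewrite omega_exp mulmx_exprD addnC. Qed.

(** * Normalising the pairings of a block *)

Section Block.
(** [P] will be the orthogonal complement of the blocks already split off, and [d] the last exponent
    for which [e ^+ d] is nonzero on it. *)
Context (P : 'rV[K]_N -> Prop) (d : nat).
Hypothesis PD : forall u v, P u -> P v -> P (u + v).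
Hypothesis PZ : forall c u, P u -> P (c *: u).
Hypothesis Pe : forall t u, P u -> P (u *m e ^+ t).
Hypothesis Pd : forall u t, P u -> (d < t)%N -> u *m e ^+ t = 0.

(** The lower pairings are cleared from [s = d - 1] downwards by adding multiples of
    [a *m e ^+ r.+1]. Even [s] need no correction; for odd [s] the exponent [r.+1] is even, so the
    two cross terms add up, whence the 2 in the denominator of [c]. *)
Lemma self_block a : odd d -> P a -> omega a (a *m e ^+ d) != 0 ->
  exists a', [/\ P a', omega a' (a' *m e ^+ d) != 0 &
    forall s, (s < d)%N -> omega a' (a' *m e ^+ s) = 0].
Proof.
move=> dodd Pa Ba.
suff /(_ d) [a' [Pa' Ba' H]] : forall r, exists a', [/\ P a', omega a' (a' *m e ^+ d) != 0 &
    forall s, (s < d)%N -> (d - s <= r)%N -> omega a' (a' *m e ^+ s) = 0].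
  by exists a'; split=> // s sd; apply: H => //; apply: leq_subr.
elim=> [|r [b [Pb Bb H]]]; first by exists a; split=> // s; rewrite -subn_gt0 ltnNge => /negPf ->.
have [dr|rd] := leqP d r.
  by exists b; split=> // s sd _; apply: H; rewrite // (leq_trans (leq_subr _ _)).
pose s0 := (d - r.+1)%N; have s0E : (r.+1 + s0)%N = d by rewrite subnKC.
have [s0odd|s0even] := boolP (odd s0); last first.
  exists b; split=> // s sd; rewrite leq_eqVlt ltnS => /orP[/eqP sE|]; last exact: H.
  by have <- : s0 = s; [rewrite /s0 -sE subKn // ltnW | apply: omega_even].
have qeven : ~~ odd r.+1 by move: dodd; rewrite -s0E oddD s0odd addbT.
pose c := - omega b (b *m e ^+ s0) / (2%:R * omega b (b *m e ^+ d)).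
have FE t : (s0 <= t)%N -> omega (b + c *: (b *m e ^+ r.+1)) ((b + c *: (b *m e ^+ r.+1)) *m e ^+ t)
    = omega b (b *m e ^+ t) + 2%:R * c * omega b (b *m e ^+ (r.+1 + t)).
  move=> st; rewrite mulmxDl -scalemxAl mulmx_exprD omegaDl !omegaDr !omegaZl !omegaZr.
  rewrite !omega_expC -signr_odd (negPf qeven) expr0 !mul1r.
  have -> : b *m e ^+ (r.+1 + (r.+1 + t)) = 0 by apply: Pd => //; lia.
  rewrite omega0r !mulr0 addr0.
  by rewrite -addrA -mulr2n mulr_natl -mulrnAl.
have big t : (s0 < t)%N -> omega b (b *m e ^+ (r.+1 + t)) = 0.
  by move=> st; rewrite (Pd Pb) ?omega0r // -s0E ltn_add2l.
exists (b + c *: (b *m e ^+ r.+1)); split.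
- by apply/PD/PZ/Pe.
- by rewrite FE ?leq_subr // big ?mulr0 ?addr0 // -s0E addSn ltnS leq_addl.
move=> s sd; rewrite leq_eqVlt ltnS => /orP[/eqP sE|sr]; last first.
  have s0s : (s0 < s)%N by rewrite /s0; lia.
  by rewrite FE ?(ltnW s0s) // H // add0r big ?mulr0.
have <- : s0 = s by rewrite /s0 -sE subKn // ltnW.
by rewrite FE // s0E [2%:R * c]mulrC -[c * _ * _]mulrA /c mulfVK ?subrr ?mulf_neq0.
Qed.

(** The same correction with multiples of [b *m e ^+ r.+1], now for odd [r.+1]. The last clause
    allows treating the second vector of a pair without spoiling its pairings with the first. *)
Lemma pair_block_isotropic a b : ~~ odd d -> P a -> P b -> omega a (b *m e ^+ d) != 0 ->
  exists a', [/\ P a', omega a' (b *m e ^+ d) != 0,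
    forall s, omega a' (a' *m e ^+ s) = 0 &
    forall z, (forall s, omega z (b *m e ^+ s) = 0) ->
      forall s, omega z (a' *m e ^+ s) = omega z (a *m e ^+ s)].
Proof.
move=> deven Pa Pb Bab.
suff /(_ d) [a' [Pa' Ba' H Hz]] : forall r, exists a', [/\ P a', omega a' (b *m e ^+ d) != 0,
    forall s, (s < d)%N -> (d - s <= r)%N -> omega a' (a' *m e ^+ s) = 0 &
    forall z, (forall s, omega z (b *m e ^+ s) = 0) ->
      forall s, omega z (a' *m e ^+ s) = omega z (a *m e ^+ s)].
  exists a'; split=> // s; have [sd|ds|->] := ltngtP s d.
  - by apply: H => //; apply: leq_subr.
  - by rewrite (Pd Pa') // omega0r.
  by apply: omega_even.
elim=> [|r [a0 [Pa0 Ba0 H Hz]]].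
  by exists a; split=> // s; rewrite -subn_gt0 ltnNge => /negPf ->.
have [dr|rd] := leqP d r.
  by exists a0; split=> // s sd _; apply: H; rewrite // (leq_trans (leq_subr _ _)).
pose s0 := (d - r.+1)%N; have s0E : (r.+1 + s0)%N = d by rewrite subnKC.
have [s0odd|s0even] := boolP (odd s0); last first.
  exists a0; split=> // s sd; rewrite leq_eqVlt ltnS => /orP[/eqP sE|]; last exact: H.
  by have <- : s0 = s; [rewrite /s0 -sE subKn // ltnW | apply: omega_even].
pose c := - omega a0 (a0 *m e ^+ s0) / (2%:R * omega a0 (b *m e ^+ d)).
have FE t : (s0 <= t)%N -> odd t ->
    omega (a0 + c *: (b *m e ^+ r.+1)) ((a0 + c *: (b *m e ^+ r.+1)) *m e ^+ t)
    = omega a0 (a0 *m e ^+ t) + 2%:R * c * omega a0 (b *m e ^+ (r.+1 + t)).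
  move=> st todd; rewrite mulmxDl -scalemxAl mulmx_exprD omegaDl !omegaDr !omegaZl !omegaZr.
  rewrite [omega (b *m _) (a0 *m _)]omegaC omega_expC -signr_odd todd expr1 mulN1r opprK.
  rewrite [(t + _)%N]addnC [omega (b *m _) _]omega_expC.
  have -> : b *m e ^+ (r.+1 + (r.+1 + t)) = 0 by apply: Pd => //; lia.
  rewrite omega0r !mulr0 addr0.
  by rewrite -addrA -mulr2n mulr_natl -mulrnAl.
have big t : (s0 < t)%N -> omega a0 (b *m e ^+ (r.+1 + t)) = 0.
  by move=> st; rewrite (Pd Pb) ?omega0r // -s0E ltn_add2l.
exists (a0 + c *: (b *m e ^+ r.+1)); split.
- by apply/PD/PZ/Pe.
- have b0 : b *m e ^+ (r.+1 + d) = 0 by apply: Pd => //; lia.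
  by rewrite omegaDl omegaZl omega_expC b0 omega0r !mulr0 addr0.
- move=> s sd; have [sodd|seven] := boolP (odd s); last by rewrite omega_even.
  rewrite leq_eqVlt ltnS => /orP[/eqP sE|sr]; last first.
    have s0s : (s0 < s)%N by rewrite /s0; lia.
    by rewrite FE ?(ltnW s0s) // H // add0r big ?mulr0.
  have <- : s0 = s by rewrite /s0 -sE subKn // ltnW.
  by rewrite FE // s0E [2%:R * c]mulrC -[c * _ * _]mulrA /c mulfVK ?subrr ?mulf_neq0.
move=> z hz s; rewrite mulmxDl -scalemxAl mulmx_exprD omegaDr omegaZr hz mulr0 addr0.
exact: Hz.
Qed.

Lemma pair_block_dual a b : P a -> P b -> omega a (b *m e ^+ d) != 0 ->
  exists b', [/\ P b', omega a (b' *m e ^+ d) != 0 &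
    forall s, (s < d)%N -> omega a (b' *m e ^+ s) = 0].
Proof.
move=> Pa Pb Bab.
suff /(_ d) [b' [Pb' Bb' H]] : forall r, exists b', [/\ P b', omega a (b' *m e ^+ d) != 0 &
    forall s, (s < d)%N -> (d - s <= r)%N -> omega a (b' *m e ^+ s) = 0].
  by exists b'; split=> // s sd; apply: H => //; apply: leq_subr.
elim=> [|r [b0 [Pb0 Bb H]]]; first by exists b; split=> // s; rewrite -subn_gt0 ltnNge => /negPf ->.
have [dr|rd] := leqP d r.
  by exists b0; split=> // s sd _; apply: H; rewrite // (leq_trans (leq_subr _ _)).
pose s0 := (d - r.+1)%N; have s0E : (r.+1 + s0)%N = d by rewrite subnKC.
pose c := - omega a (b0 *m e ^+ s0) / omega a (b0 *m e ^+ d).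
have FE t : omega a ((b0 + c *: (b0 *m e ^+ r.+1)) *m e ^+ t)
    = omega a (b0 *m e ^+ t) + c * omega a (b0 *m e ^+ (r.+1 + t)).
  by rewrite mulmxDl -scalemxAl mulmx_exprD omegaDr omegaZr.
have big t : (s0 < t)%N -> omega a (b0 *m e ^+ (r.+1 + t)) = 0.
  by move=> st; rewrite (Pd Pb0) ?omega0r // -s0E ltn_add2l.
exists (b0 + c *: (b0 *m e ^+ r.+1)); split.
- by apply/PD/PZ/Pe.
- by rewrite FE big ?mulr0 ?addr0 // -s0E addSn ltnS leq_addl.
move=> s sd; rewrite leq_eqVlt ltnS => /orP[/eqP sE|sr]; last first.
  have s0s : (s0 < s)%N by rewrite /s0; lia.
  by rewrite FE H // add0r big ?mulr0.
have <- : s0 = s by rewrite /s0 -sE subKn // ltnW.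
by rewrite FE s0E /c mulfVK // subrr.
Qed.

End Block.

(* [pr] is the involution [i -> i'] of the symplectic Jordan basis [w i *m e ^+ s];
   dual blocks are adjacent. *)
Record symp_jordan k (D : nat -> nat) (w : nat -> 'rV[K]_N) (pr : nat -> nat) (c : nat -> K) :=
  SympJordan {
    sj_dec : forall i j, (i <= j)%N -> (j < k)%N -> (D j <= D i)%N;
    sj_gt0 : forall i, (i < k)%N -> (0 < D i)%N;
    sj_pr_lt : forall i, (i < k)%N -> (pr i < k)%N;
    sj_prK : forall i, (i < k)%N -> pr (pr i) = i;
    sj_D_pr : forall i, (i < k)%N -> D (pr i) = D i;
    sj_pr_near : forall i, (i < k)%N -> (pr i <= i.+1)%N && (i <= (pr i).+1)%N;
    sj_c_neq0 : forall i, (i < k)%N -> c i != 0;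
    sj_c_pr : forall i, (i < k)%N -> pr i != i -> c (pr i) = - c i;
    sj_omega : forall i j s, (i < k)%N -> (j < k)%N ->
      omega (w i) (w j *m e ^+ s) = if (j == pr i) && (s.+1 == D i) then c i else 0;
    sj_exp0 : forall i, (i < k)%N -> w i *m e ^+ D i = 0 }.

Definition sj_perp k (w : nat -> 'rV[K]_N) v :=
  forall i s, (i < k)%N -> omega (w i) (v *m e ^+ s) = 0.

(** Pairing with the dual generator, rescaled to read the coefficient of [w l *m e ^+ (D l).-1]. *)
Definition sj_phi (w : nat -> 'rV[K]_N) (pr : nat -> nat) (c : nat -> K) l : 'cV[K]_N :=
  (c (pr l))^-1 *: (w (pr l) *m J)^T.

Lemma sj_phiE w pr c l v :
  (v *m sj_phi w pr c l) 0 0 = (c (pr l))^-1 * omega (w (pr l)) v.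
Proof.
rewrite /sj_phi -scalemxAr mxE; congr (_ * _).
transitivity ((v *m (w (pr l) *m J)^T)^T 0 0); first by rewrite [RHS]mxE.
by rewrite trmx_mul trmxK.
Qed.

(** * Enlarging a symplectic Jordan system *)

Section SympJordanTheory.
Context (k : nat) (D : nat -> nat) (w : nat -> 'rV[K]_N) (pr : nat -> nat) (c : nat -> K).
Hypothesis sj : symp_jordan k D w pr c.
Local Notation phi := (sj_phi w pr c).

Lemma sj_w_phi i l t : (i < k)%N -> (l < k)%N ->
  (w i *m e ^+ t *m phi l) 0 0 = ((i == l) && (t.+1 == D l))%:R.
Proof.
move=> ik lk; have plk := sj_pr_lt sj lk.
rewrite sj_phiE (sj_omega sj) // (sj_prK sj) // (sj_D_pr sj) //.
by case: ifP => _; rewrite ?mulr0 // mulVf // (sj_c_neq0 sj).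
Qed.

Lemma sj_phiD l : (l < k)%N -> e ^+ D l *m phi l = 0.
Proof.
move=> lk; apply/colP => i; rewrite [RHS]mxE.
transitivity (((delta_mx 0 i : 'rV_N) *m e ^+ D l *m phi l) 0 0).
  by rewrite -mulmxA -rowE [RHS]mxE.
rewrite sj_phiE omegaC omega_exp.
rewrite -[D l](sj_D_pr sj lk) (sj_exp0 sj (sj_pr_lt sj lk)).
by rewrite omega0r mulr0 oppr0 mulr0.
Qed.

Lemma sj_perp_phi v : (forall l t, (l < k)%N -> (v *m e ^+ t *m phi l) 0 0 = 0) -> sj_perp k w v.
Proof.
move=> h i s ik; have plk := sj_pr_lt sj ik; have := h _ s plk.
rewrite sj_phiE (sj_prK sj) // => /eqP; rewrite mulf_eq0 invr_eq0.
by rewrite (negPf (sj_c_neq0 sj ik)) => /eqP.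
Qed.

Lemma sj_perp_omega_exp u i s : sj_perp k w u -> (i < k)%N -> omega u (w i *m e ^+ s) = 0.
Proof. by move=> Pu ik; rewrite omegaC omega_exp Pu // mulr0 oppr0. Qed.

(** The Jordan projection of [v] lies in the blocks, to which [u] is orthogonal, so it can be
    subtracted. *)
Lemma sj_perp_nondeg u v : sj_perp k w u -> omega u v != 0 ->
  exists2 v', sj_perp k w v' & omega u v' != 0.
Proof.
move=> Pu uv; exists (v - jordan_proj e k D w phi v).
  apply: sj_perp_phi => l t lk; apply: jordan_residue lk => //; first exact: sj_w_phi.
  exact: sj_phiD.
rewrite omegaDr -scaleN1r omegaZr /jordan_proj omega_sumr big1 ?mulr0 ?addr0 // => l _.
by rewrite omega_sumr big1 // => s _; rewrite omegaZr sj_perp_omega_exp ?mulr0.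
Qed.

Lemma sj_perpD u v : sj_perp k w u -> sj_perp k w v -> sj_perp k w (u + v).
Proof. by move=> hu hv i s ik; rewrite mulmxDl omegaDr hu // hv // addr0. Qed.

Lemma sj_perpZ (x : K) u : sj_perp k w u -> sj_perp k w (x *: u).
Proof. by move=> hu i s ik; rewrite -scalemxAl omegaZr hu // mulr0. Qed.

Lemma sj_perp_exp t u : sj_perp k w u -> sj_perp k w (u *m e ^+ t).
Proof. by move=> hu i s ik; rewrite mulmx_exprD hu. Qed.

Lemma sj_size : (k <= N)%N.
Proof. exact: (jordan_rank sj_w_phi (sj_gt0 sj)). Qed.

Lemma sj_append (b d : nat) (wb : nat -> 'rV[K]_N) (prb : nat -> nat) (cb : nat -> K) :
  (forall i, (i < b)%N -> sj_perp k w (wb i)) ->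
  (forall i, (i < k)%N -> (d.+1 <= D i)%N) ->
  (forall i, (i < b)%N -> (prb i < b)%N) ->
  (forall i, (i < b)%N -> prb (prb i) = i) ->
  (forall i, (i < b)%N -> (prb i <= i.+1)%N && (i <= (prb i).+1)%N) ->
  (forall i, (i < b)%N -> cb i != 0) ->
  (forall i, (i < b)%N -> prb i != i -> cb (prb i) = - cb i) ->
  (forall i j s, (i < b)%N -> (j < b)%N ->
    omega (wb i) (wb j *m e ^+ s) = if (j == prb i) && (s == d) then cb i else 0) ->
  (forall i, (i < b)%N -> wb i *m e ^+ d.+1 = 0) ->
  let ext T (f g : nat -> T) (i : nat) := if (i < k)%N then f i else g (i - k)%N in
  symp_jordan (k + b) (ext _ D (fun=> d.+1)) (ext _ w wb)
    (ext _ pr (fun i => k + prb i)%N) (ext _ c cb).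
Proof.
move=> Pb dD prb_lt prbK prb_near cb0 cb_pr om_b exp_b ext.
have lo T (f g : nat -> T) i : (i < k)%N -> ext T f g i = f i by rewrite /ext => ->.
have hi T (f g : nat -> T) i : ext T f g (k + i)%N = g i.
  by rewrite /ext ltnNge leq_addr /= addKn.
have splitk i : (i < k + b)%N -> (i < k)%N \/ exists2 i', i = (k + i')%N & (i' < b)%N.
  have [ik _|ki ib] := ltnP i k; [by left | right].
  by exists (i - k)%N; rewrite ?subnKC // ltn_subLR.
clearbody ext; split.
- move=> i j ij jkb; have ikb := leq_ltn_trans ij jkb.
  have [jk|[j' jE j'b]] := splitk j jkb; first by rewrite !lo ?(sj_dec sj) // (leq_ltn_trans ij).
  have [ik|[i' -> _]] := splitk i ikb; first by rewrite jE hi lo // dD.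
  by rewrite jE !hi.
- by move=> i /splitk[ik|[i' -> _]]; rewrite ?hi // lo // (sj_gt0 sj).
- move=> i /splitk[ik|[i' -> i'b]]; last by rewrite hi ltn_add2l prb_lt.
  by rewrite lo // (leq_trans (sj_pr_lt sj ik)) // leq_addr.
- move=> i /splitk[ik|[i' -> i'b]]; last by rewrite !hi prbK.
  by rewrite [ext _ _ _ i]lo // lo ?(sj_prK sj) // (sj_pr_lt sj).
- move=> i /splitk[ik|[i' -> i'b]]; last by rewrite !hi.
  by rewrite [ext _ pr _ i]lo // !lo ?(sj_D_pr sj) // (sj_pr_lt sj).
- move=> i /splitk[ik|[i' -> i'b]]; last by rewrite hi -!addnS !leq_add2l prb_near.
  by rewrite lo // (sj_pr_near sj).
- by move=> i /splitk[ik|[i' -> i'b]]; rewrite ?hi ?cb0 // lo // (sj_c_neq0 sj).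
- move=> i /splitk[ik|[i' -> i'b]]; last first.
    by rewrite !hi eqn_add2l; apply: cb_pr.
  by rewrite [ext _ pr _ i]lo // !lo ?(sj_pr_lt sj) //; exact: (sj_c_pr sj).
- move=> i j s /splitk[ik|[i' -> i'b]] /splitk[jk|[j' -> j'b]].
  + by rewrite !lo // (sj_omega sj).
  + rewrite hi !lo // Pb // (_ : (_ == pr i) = false) //.
    by apply: gtn_eqF; rewrite (leq_trans (sj_pr_lt sj ik)) // leq_addr.
  + have ji : (j == k + prb i')%N = false.
      by apply: ltn_eqF; rewrite (leq_trans jk) // leq_addr.
    rewrite (hi _ w) (lo _ w) // (hi _ pr) ji /=.
    exact: sj_perp_omega_exp (Pb _ i'b) jk.
  by rewrite !hi om_b // eqn_add2l eqSS.
by move=> i /splitk[ik|[i' -> i'b]]; rewrite ?hi ?exp_b // !lo // (sj_exp0 sj).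
Qed.

End SympJordanTheory.

(** This invariant keeps the next block no larger than the earlier ones. *)
Definition sj_sharp k D w :=
  forall v i, sj_perp k w v -> (i < k)%N -> v *m e ^+ D i = 0.

(** Let [e ^+ d] be the last nonzero power on the complement. The form [omega u (v *m e ^+ d)] is
    nonzero there, symmetric for odd [d] and alternating for even [d]; it yields a self-dual block
    in the first case, a pair of dual blocks in the second. *)
Lemma sj_extend r k D w pr c : e ^+ r = 0 -> symp_jordan k D w pr c -> sj_sharp k D w ->
  (exists2 u, sj_perp k w u & u != 0) ->
  exists k' D' w' pr' c', [/\ (k < k')%N, symp_jordan k' D' w' pr' c' & sj_sharp k' D' w'].
Proof.
move=> er sj sharp [u0 Pu0 u0nz].
have [d [Pd [u Pu ud]]] : exists d, (forall v, sj_perp k w v -> v *m e ^+ d.+1 = 0) /\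
    exists2 u, sj_perp k w u & u *m e ^+ d != 0.
  have : forall v, sj_perp k w v -> v *m e ^+ r = 0 by move=> v _; rewrite er mulmx0.
  elim: r {er} => [|r IHr] h.
    by have := h _ Pu0; rewrite expr0 -[1]/(1%:M) mulmx1 => E; rewrite E eqxx in u0nz.
  have [h'|h'] := classic (forall v, sj_perp k w v -> v *m e ^+ r = 0); first exact: IHr.
  exists r; split=> //; have [u hu] := not_all_ex_not _ _ h'.
  by have [Pu /eqP ur] := imply_to_and _ _ hu; exists u.
have Pd' v t : sj_perp k w v -> (d < t)%N -> v *m e ^+ t = 0.
  by move=> Pv dt; rewrite -(subnKC dt) exprD -mulmxE mulmxA Pd // mul0mx.
have PD := @sj_perpD k w; have PZ := @sj_perpZ k w; have Pe := @sj_perp_exp k w.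
have dD i : (i < k)%N -> (d < D i)%N.
  move=> ik; rewrite ltnNge; apply: contraNN ud => Did; rewrite -(subnKC Did) exprD -mulmxE.
  by rewrite mulmxA sharp // mul0mx.
have [v Pv uv] : exists2 v, sj_perp k w v & omega u (v *m e ^+ d) != 0.
  have [v hv] : exists v, omega (u *m e ^+ d) v <> 0.
    by apply: not_all_ex_not => h; case/negP: ud; apply/eqP/omega_nondeg.
  have [v' Pv' hv'] := sj_perp_nondeg sj (Pe d _ Pu) (introN eqP hv).
  by exists v' => //; apply: contraNneq hv' => E; rewrite omega_exp E mulr0.
have main (b : nat) (wb : nat -> 'rV_N) (prb : nat -> nat) (cb : nat -> K) : (0 < b)%N ->
  (forall i, (i < b)%N -> sj_perp k w (wb i)) ->
  (forall i, (i < b)%N -> (prb i < b)%N) ->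
  (forall i, (i < b)%N -> prb (prb i) = i) ->
  (forall i, (i < b)%N -> (prb i <= i.+1)%N && (i <= (prb i).+1)%N) ->
  (forall i, (i < b)%N -> cb i != 0) ->
  (forall i, (i < b)%N -> prb i != i -> cb (prb i) = - cb i) ->
  (forall i j s, (i < b)%N -> (j < b)%N ->
    omega (wb i) (wb j *m e ^+ s) = if (j == prb i) && (s == d) then cb i else 0) ->
  exists k' D' w' pr' c', [/\ (k < k')%N, symp_jordan k' D' w' pr' c' & sj_sharp k' D' w'].
  move=> b0 Pb h1 h2 h3 h4 h5 h6.
  have := sj_append sj Pb dD h1 h2 h3 h4 h5 h6 (fun i ib => Pd _ (Pb i ib)).
  move=> /= H; do 5!eexists; split; [|exact: H|]; first by rewrite -[X in (X < _)%N]addn0 ltn_add2l.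
  move=> z i Pz ikb; have Pz' : sj_perp k w z.
    by move=> j s jk; have := Pz j s (leq_trans jk (leq_addr _ _)); rewrite jk.
  by case: ifP => ik; [apply: sharp | apply: Pd].
have [dodd|deven] := boolP (odd d).
  have Bsym : omega v (u *m e ^+ d) = omega u (v *m e ^+ d).
    by rewrite omegaC omega_exp -signr_odd dodd expr1 mulN1r opprK.
  (* Polarisation: a nonzero symmetric form has an anisotropic vector, 2 being nonzero. *)
  have [a Pa aa] : exists2 a, sj_perp k w a & omega a (a *m e ^+ d) != 0.
    have [uu|] := eqVneq (omega u (u *m e ^+ d)) 0; last by exists u.
    have [vv|] := eqVneq (omega v (v *m e ^+ d)) 0; last by exists v.
    exists (u + v); first exact: PD.
    rewrite mulmxDl omegaDl !omegaDr uu vv Bsym add0r addr0 -mulr2n -mulr_natl.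
    by rewrite mulf_neq0.
  have [a' [Pa' aa' H]] := self_block PD PZ Pe Pd' dodd Pa aa.
  apply: (main 1%N (fun=> a') id (fun=> omega a' (a' *m e ^+ d))) => //.
  - by move=> i _; rewrite leqnSn.
  - by move=> i _; rewrite eqxx.
  move=> [|//] [|//] s _ _ /=; have [sd|ds|->//] := ltngtP s d; first exact: H.
  by rewrite (Pd' a') // omega0r.
(* Three moves: [u1] is isotropic for all powers, [v1] pairs with [u1] in the top power only, and
   [v2] is isotropic with the same pairings with [u1] as [v1]. *)
have [u1 [Pu1 u1v Fu1 _]] := pair_block_isotropic PD PZ Pe Pd' deven Pu Pv uv.
have [v1 [Pv1 u1v1 G1]] := pair_block_dual PD PZ Pe Pd' Pu1 Pv u1v.
have swap x y s : omega x (y *m e ^+ s) = - (-1) ^+ s * omega y (x *m e ^+ s).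
  by rewrite omegaC omega_exp mulNr.
have v1u1 : omega v1 (u1 *m e ^+ d) != 0.
  by rewrite swap -signr_odd (negPf deven) expr0 mulN1r oppr_eq0.
have [v2 [Pv2 v2u1 Fv2 Hz]] := pair_block_isotropic PD PZ Pe Pd' deven Pv1 Pu1 v1u1.
have {}Hz := Hz _ Fu1.
have G s : omega u1 (v2 *m e ^+ s) = if s == d then omega u1 (v2 *m e ^+ d) else 0.
  have [sd|ds|->//] := ltngtP s d; first by rewrite Hz G1.
  by rewrite (Pd' v2) // omega0r.
pose wb i := if i == 0%N then u1 else v2.
pose cb i := if i == 0%N then omega u1 (v2 *m e ^+ d) else - omega u1 (v2 *m e ^+ d).
apply: (main 2%N wb (fun i => 1 - i)%N cb) => //.
- by case=> [|[]].
- by case=> [|[]].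
- by case=> [|[]].
- by case=> [|[]].
- by case=> [|[|//]] _; rewrite /cb /= ?oppr_eq0 Hz.
- by case=> [|[|//]] _ _; rewrite /cb /= ?opprK.
move=> [|[|//]] [|[|//]] s _ _; rewrite /wb /cb /=.
- exact: Fu1.
- by rewrite G.
- rewrite swap G; case: eqP => [->|_]; last by rewrite mulr0.
  by rewrite -signr_odd (negPf deven) expr0 mulN1r.
exact: Fv2.
Qed.

(** Blocks are added to the empty system until the complement is 0; [sj_size] bounds their number by
    [N]. *)
Lemma symp_jordan_exists r : e ^+ r = 0 ->
  exists k D w pr c, symp_jordan k D w pr c /\ forall v, sj_perp k w v -> v = 0.
Proof.
move=> er.
suff H n k D w pr c : (N - k < n)%N -> symp_jordan k D w pr c -> sj_sharp k D w ->
    exists k D w pr c, symp_jordan k D w pr c /\ forall v, sj_perp k w v -> v = 0.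
  by apply: (H N.+1 0%N (fun=> 0%N) (fun=> 0) id (fun=> 0)); rewrite ?ltnS ?leq_subr.
elim: n k D w pr c => // n IHn k D w pr c kn sj sharp.
have [h|h] := classic (forall v, sj_perp k w v -> v = 0); first by exists k, D, w, pr, c.
have [v hv] := not_all_ex_not _ _ h; have [Pv /eqP v0] := imply_to_and _ _ hv.
have [|k' [D' [w' [pr' [c' [kk' sj' sharp']]]]]] := sj_extend er sj sharp; first by exists v.
have := sj_size sj'; have := sj_size sj => h1 h2.
by apply: IHn sj' sharp'; lia.
Qed.

End Form.

(** * The centraliser in the symplectic Lie algebra *)

Lemma tr_symp_J (K : fieldType) n : (symp_J K n)^T = - symp_J K n.
Proof.
by rewrite /symp_J tr_block_mx opp_block_mx !trmx0 !oppr0 opprK linearN /= trmx1.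
Qed.

Lemma symp_J_sqr (K : fieldType) n : symp_J K n *m symp_J K n = - 1%:M.
Proof.
rewrite /symp_J mulmx_block !mul0mx !mulmx0 !add0r !addr0 mul1mx mulmx1.
by rewrite -[1%:M in RHS]/(scalar_mx 1) (scalar_mx_block n n) opp_block_mx !oppr0.
Qed.

Lemma symp_J_unit (K : fieldType) n : symp_J K n \in unitmx.
Proof.
have : symp_J K n *m (- symp_J K n) = 1%:M by rewrite mulmxN symp_J_sqr opprK.
by case/mulmx1_unit.
Qed.

Section Sign.
Context (K : fieldType) (n : nat).
Local Notation N := (n + n)%N.
Local Notation J := (symp_J K n).
Hypothesis K2 : (2%:R : K) != 0.
Implicit Types X Y Z : 'M[K]_N.

Lemma in_spE X : in_sp X <-> symp_sign J 1 X.
Proof.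
have JJ (A : 'M_N) : A *m J *m J = - A by rewrite -mulmxA symp_J_sqr mulmxN mulmx1.
have JJl (A : 'M_N) : J *m (J *m A) = - A by rewrite mulmxA symp_J_sqr mulNmx mul1mx.
rewrite /in_sp /symp_sign expr1 scaleN1r; split=> h.
  have XT : J *m X = - (X^T *m J) by apply/eqP; rewrite -addr_eq0 addrC h.
  have -> : X^T = J *m X *m J by rewrite XT mulNmx JJ opprK.
  by rewrite -mulmxA JJl opprK.
have XE : J *m X^T = - (X *m J) by rewrite h opprK.
have {2}-> : X = J *m X^T *m J by rewrite XE mulNmx JJ opprK.
by rewrite -mulmxA JJl subrr.
Qed.

Lemma mxtrace_trmul (A Y : 'M[K]_N) :
  \tr (A^T *m Y) = (mxvec Y *m (mxvec A)^T) 0 0.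
Proof.
transitivity (\sum_i \sum_j Y i j * A i j).
  rewrite exchange_big; apply: eq_bigr => i _; rewrite mxE.
  by apply: eq_bigr => j _; rewrite mxE mulrC.
rewrite mxE (reindex _ (curry_mxvec_bij _ _)) pair_bigA.
by apply: eq_bigr => -[i j] _; rewrite [(mxvec A)^T _ _]mxE !mxvecE.
Qed.

(** Transposing the product shows that its trace equals its own opposite. *)
Lemma mxtrace_symp_sign (X P : 'M[K]_N) :
  symp_sign J 1 X -> symp_sign J 0 P -> \tr (X *m P) = 0.
Proof.
rewrite /symp_sign expr1 expr0 scaleN1r scale1r => XJ PJ; apply: (eq_opp0 K2).
have Ju := symp_J_unit K n.
have XT : X^T = - (invmx J *m X *m J) by rewrite -mulmxA XJ mulmxN opprK mulKmx.
have PT : P^T = invmx J *m P *m J by rewrite -mulmxA PJ mulKmx.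
rewrite -[LHS]mxtrace_tr trmx_mul PT XT mulmxN linearN /=; congr (- _).
rewrite -!mulmxA [J *m (invmx J *m _)]mulmxA mulmxV // mul1mx mxtrace_mulC -!mulmxA.
by rewrite mulmxV // mulmx1 mxtrace_mulC.
Qed.

Lemma symp_sign_br X Y b c : symp_sign J b X -> symp_sign J c Y ->
  symp_sign J (b + c).+1 (lie_br X Y).
Proof.
rewrite /symp_sign /lie_br => XJ YJ.
rewrite mulmxBl -!mulmxA XJ YJ -!scalemxAr !mulmxA XJ YJ -!scalemxAl -!mulmxA -!trmx_mul.
rewrite !scalerA -!exprD addnC -scalerBr -mulmxBr exprS mulN1r scaleNr -scalerN -mulmxN.
by congr (_ *: (_ *m _)); rewrite linearB /= opprB.
Qed.

(** Minus the adjoint for the symplectic form, as [J] squares to -1: an involution that fixes sp and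
    negates the self-adjoint matrices. *)
Definition symp_adj X := J *m X^T *m J.

Lemma symp_adj_sign X (b : nat) : symp_sign J b (X - (-1) ^+ b *: symp_adj X).
Proof.
have JJ (A : 'M_N) : A *m J *m J = - A by rewrite -mulmxA symp_J_sqr mulmxN mulmx1.
have JJl (A : 'M_N) : J *m J *m A = - A by rewrite symp_J_sqr mulNmx mul1mx.
rewrite /symp_sign /symp_adj mulmxBl -scalemxAl JJ scalerN opprK.
rewrite linearB linearZ /= !trmx_mul trmxK tr_symp_J !mulmxBr -scalemxAr mulNmx !mulmxN.
rewrite !mulmxA JJl mulNmx !opprK scalerBr scalerA -exprD.
by rewrite -[(-1) ^+ (b + b)]signr_odd oddD addbb expr0 scale1r opprK addrC.
Qed.
End Sign.

(** * Linear forms on the centraliser and their stabilisers *)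

Section Centraliser.
Context (K : closedFieldType) (n d : nat).
Local Notation N := (n + n)%N.
Local Notation J := (symp_J K n).
Context (e : 'M[K]_N) (B : 'M[K]_(d, N * N)).
Hypothesis K2 : (2%:R : K) != 0.
Hypothesis eJ : symp_sign J 1 e.
Hypothesis hB : is_basis_centraliser e B.
Implicit Types (x y z : 'M[K]_N) (c : 'I_d -> K).

Lemma lie_br_eq0 y : lie_br y e = 0 <-> y *m e = e *m y.
Proof. by rewrite /lie_br; split=> [/eqP|->]; rewrite ?subrr // subr_eq0 => /eqP. Qed.

Lemma centraliserE y : (mxvec y <= B)%MS <-> symp_sign J 1 y /\ y *m e = e *m y.
Proof.
split=> [/(hB.2 _)[/in_spE ? /lie_br_eq0 ?] // | [? ?]].
by apply/(hB.2 _); split; [apply/in_spE | apply/lie_br_eq0].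
Qed.

Lemma br_commute y z : y *m e = e *m y -> z *m e = e *m z ->
  lie_br y z *m e = e *m lie_br y z.
Proof.
move=> ye ze; rewrite /lie_br mulmxBl mulmxBr -!mulmxA ye ze !mulmxA ye ze.
by [].
Qed.

Lemma centraliser_br y z : (mxvec y <= B)%MS -> (mxvec z <= B)%MS -> (mxvec (lie_br y z) <= B)%MS.
Proof.
move=> /centraliserE[yJ ye] /centraliserE[zJ ze]; apply/centraliserE; split; last exact: br_commute.
have := symp_sign_br yJ zJ.
by rewrite /symp_sign -signr_odd.
Qed.

Lemma bas_centraliser i : (mxvec (bas B i) <= B)%MS.
Proof. by rewrite /bas vec_mxK row_sub. Qed.

Definition represents c x := forall y, (mxvec y <= B)%MS -> gam B c y = \tr (x *m y).

Lemma represents_bas x : represents (fun i => \tr (x *m bas B i)) x.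
Proof.
move=> y yB; have E := mulmxKpV yB; rewrite /gam.
have yE : y = \sum_i (mxvec y *m pinvmx B) 0 i *: bas B i.
  rewrite -{1}[y]mxvecK -{1}E mulmx_sum_row linear_sum; apply: eq_bigr => i _ /=.
  by rewrite linearZ.
transitivity (\tr (x *m \sum_i (mxvec y *m pinvmx B) 0 i *: bas B i)); last by rewrite -yE.
rewrite mulmx_sumr linear_sum; apply: eq_bigr => i _ /=.
by rewrite -scalemxAr linearZ.
Qed.

(** An extension of the form to all matrices is a trace form [x0]; averaging [x0] with [symp_adj x0]
    removes its self-adjoint part, which pairs to 0 with sp. *)
Lemma represents_exists c : exists2 x, symp_sign J 1 x & represents c x.
Proof.
pose psi : 'cV_d := \col_i c i; pose x0 := (vec_mx (pinvmx B *m psi)^T)^T.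
exists (2%:R^-1 *: (x0 - (-1) ^+ 1 *: symp_adj x0)); first exact/symp_signZ/symp_adj_sign.
move=> y yB; have [yJ _] := (centraliserE y).1 yB.
have x0E : \tr (x0 *m y) = gam B c y.
  rewrite /x0 mxtrace_trmul vec_mxK trmxK mulmxA mxE.
  by apply: eq_bigr => i _; rewrite !mxE.
have := mxtrace_symp_sign K2 yJ (symp_adj_sign x0 0).
rewrite expr0 scale1r mulmxBr linearB /= => /eqP; rewrite subr_eq0 => /eqP adjE.
rewrite expr1 scaleN1r opprK -scalemxAl linearZ /= mulmxDl linearD /= x0E.
rewrite [\tr (symp_adj _ *m y)]mxtrace_mulC -adjE mxtrace_mulC x0E.
by rewrite -mulr2n -[gam _ _ _ *+ 2]mulr_natl mulKf.
Qed.

Lemma stab_rowP c x (u : 'rV_d) : represents c x ->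
  (u *m gam_form B c == 0) =
  [forall j, \tr (x *m lie_br (vec_mx (u *m B)) (bas B j)) == 0].
Proof.
move=> cx.
have rowE j : (u *m gam_form B c) 0 j = \tr (x *m lie_br (vec_mx (u *m B)) (bas B j)).
  have -> : vec_mx (u *m B) = \sum_i u 0 i *: bas B i.
    by rewrite mulmx_sum_row linear_sum; apply: eq_bigr => i _ /=; rewrite linearZ.
  rewrite /lie_br mulmx_suml mulmx_sumr -sumrB mulmx_sumr linear_sum mxE.
  apply: eq_bigr => i _; rewrite mxE cx; last by apply: centraliser_br; apply: bas_centraliser.
  by rewrite -scalemxAl -scalemxAr -scalerBr -scalemxAr /= linearZ.
apply/eqP/forallP => [E j|h]; first by rewrite -rowE E mxE.
by apply/rowP => j; rewrite rowE (eqP (h j)) mxE.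
Qed.

Lemma stab_dim_ge c : (n <= stab_dim B c)%N.
Proof.
have [x xJ cx] := represents_exists c.
have [Y Yfree Yst] := stabiliser_lower_bound eJ xJ true.
have YB : (Y <= B)%MS.
  apply/row_subP => i; rewrite -[row i Y]vec_mxK; apply/centraliserE.
  by have [? ? _] := Yst i.
have YE := mulmxKpV YB; rewrite -{1}(eqP Yfree) -{1}YE.
apply: leq_trans (mxrankM_maxl _ _) _; apply: mxrankS; apply/row_subP => i.
apply/sub_kermxP/eqP; rewrite (stab_rowP _ cx) -row_mul YE; apply/forallP => j.
have [_ _ ->] := Yst i; rewrite ?eqxx //.
by have [_ ->] := (centraliserE _).1 (bas_centraliser j).
Qed.

(** [z] is half the sum of [zs], which lies in the centraliser in sp, and of the self-adjoint [zp];
    the bracket of [y] with [zp] is self-adjoint, hence orthogonal to [x]. *)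
Lemma commutant_stab c x y : symp_sign J 1 x -> represents c x -> (mxvec y <= B)%MS ->
  (forall j, \tr (x *m lie_br y (bas B j)) = 0) ->
  forall z, z *m e = e *m z -> \tr (x *m lie_br y z) = 0.
Proof.
move=> xJ cx yB hy z ze.
have adj_e : symp_adj z *m e = e *m symp_adj z.
  have JJ (A : 'M_N) : A *m J *m J = - A by rewrite -mulmxA symp_J_sqr mulmxN mulmx1.
  have eJ' : e *m J = - (J *m e^T) by rewrite eJ expr1 scaleN1r.
  have Je : J *m e = - (e^T *m J).
    have := (in_spE e).2 eJ; rewrite /in_sp => /eqP.
    by rewrite addrC addr_eq0 => /eqP.
  rewrite /symp_adj -!mulmxA Je [RHS]mulmxA eJ' !mulmxN mulNmx; congr (- _).
  rewrite -mulmxA [z^T *m (e^T *m J)]mulmxA [e^T *m (z^T *m J)]mulmxA.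
  by rewrite -[z^T *m e^T]trmx_mul -[e^T *m z^T]trmx_mul ze.
pose zs : 'M_N := z - (-1) ^+ 1 *: symp_adj z; pose zp : 'M_N := z - (-1) ^+ 0 *: symp_adj z.
have zE : z = 2%:R^-1 *: (zs + zp).
  rewrite /zs /zp expr1 scaleN1r opprK expr0 scale1r addrACA subrr addr0.
  by rewrite -mulr2n -scaler_nat scalerA mulVf // scale1r.
have [yJ ye] := (centraliserE y).1 yB.
have brD a b : lie_br y (a + b) = lie_br y a + lie_br y b.
  by rewrite /lie_br mulmxDr mulmxDl opprD addrACA.
have brZ a b : lie_br y (a *: b) = a *: lie_br y b.
  by rewrite /lie_br -scalemxAr -scalemxAl scalerBr.
have zsB : (mxvec zs <= B)%MS.
  apply/centraliserE; split; first exact: symp_adj_sign.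
  by rewrite /zs mulmxBl mulmxBr -scalemxAl -scalemxAr ze adj_e.
rewrite zE brZ brD -scalemxAr linearZ mulmxDr linearD /=.
have -> : \tr (x *m lie_br y zp) = 0.
  apply: (mxtrace_symp_sign K2 xJ).
  have := symp_sign_br yJ (symp_adj_sign z 0); rewrite -/zp /symp_sign.
  by rewrite -signr_odd.
rewrite addr0; apply/eqP; rewrite mulf_eq0; apply/orP; right.
have E := mulmxKpV zsB.
have -> : zs = \sum_i (mxvec zs *m pinvmx B) 0 i *: bas B i.
  rewrite -{1}[zs]mxvecK -{1}E mulmx_sum_row linear_sum; apply: eq_bigr => i _ /=.
  by rewrite linearZ.
have br0 : lie_br y 0 = 0 by rewrite /lie_br mulmx0 mul0mx subrr.
rewrite (big_morph (lie_br y) brD br0) mulmx_sumr linear_sum big1 // => j _.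
by rewrite /= brZ -scalemxAr linearZ /= hy mulr0.
Qed.

(* The stabiliser of [tr (x *m _)] in the centraliser of [e] in [gl] has dimension at most
   [2n] by [v0]; its self-adjoint part has dimension at least [n]. *)
Lemma stab_dim_le c x (v0 : 'rV[K]_N) : symp_sign J 1 x -> represents c x ->
  (forall y, y *m e = e *m y -> (forall z, z *m e = e *m z -> \tr (x *m lie_br y z) = 0) ->
    v0 *m y = 0 -> y = 0) ->
  (stab_dim B c <= n)%N.
Proof.
move=> xJ cx v0P.
have [Y Yfree Yst] := stabiliser_lower_bound eJ xJ false.
pose S := kermx (gam_form B c) *m B.
have rS : \rank S = stab_dim B c by rewrite mxrankMfree ?hB.1.
have Sst (r : 'rV_(N * N)) : (r <= S)%MS -> [/\ symp_sign J 1 (vec_mx r),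
    vec_mx r *m e = e *m vec_mx r &
    forall z, z *m e = e *m z -> \tr (x *m lie_br (vec_mx r) z) = 0].
  case/submxP => a; rewrite mulmxA; set u := a *m _ => ->.
  have uker : u *m gam_form B c = 0 by rewrite /u -mulmxA mulmx_ker mulmx0.
  have uB : (mxvec (vec_mx (u *m B)) <= B)%MS by rewrite vec_mxK submxMl.
  have [? ?] := (centraliserE _).1 uB; split=> //.
  apply: (commutant_stab xJ cx) => // j; apply/eqP; move/eqP: uker.
  by rewrite (stab_rowP u cx) => /forallP/(_ j).
have Yst' (r : 'rV_(N * N)) : (r <= Y)%MS -> [/\ symp_sign J 0 (vec_mx r),
    vec_mx r *m e = e *m vec_mx r &
    forall z, z *m e = e *m z -> \tr (x *m lie_br (vec_mx r) z) = 0].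
  case/submxP => a ->; rewrite mulmx_sum_row linear_sum; split.
  - apply: big_ind => [|*|i _]; first by rewrite /symp_sign mul0mx trmx0 mulmx0 scaler0.
      exact: symp_signD.
    by rewrite linearZ; apply: symp_signZ; have [] := Yst i.
  - rewrite mulmx_suml mulmx_sumr; apply: eq_bigr => i _.
    by rewrite linearZ /= -scalemxAl -scalemxAr; have [_ -> _] := Yst i.
  move=> z ze; rewrite /lie_br mulmx_suml mulmx_sumr -sumrB mulmx_sumr linear_sum big1 // => i _.
  rewrite linearZ /= -scalemxAl -scalemxAr -scalerBr -scalemxAr linearZ /=.
  by have [_ _ h] := Yst i; rewrite [\tr _](h z ze) mulr0.
have SY : (S :&: Y)%MS = 0.
  apply/eqP/rowV0P => r; rewrite sub_capmx => /andP[/Sst[rS1 _ _] /Yst'[rY0 _ _]].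
  have : vec_mx r *m J = 0.
    apply/eqP; rewrite -[_ == 0](_ : (2%:R *: (vec_mx r *m J) == 0) = _); last first.
      by rewrite scaler_eq0 (negPf K2).
    by rewrite scaler_nat mulr2n {1}rS1 rY0 expr1 expr0 scaleN1r scale1r addNr.
  move=> E; rewrite -[r]vec_mxK; have -> : vec_mx r = 0; last by rewrite linear0.
  by rewrite -[vec_mx r](mulmxK (symp_J_unit K n)) E mul0mx.
(* Evaluation at [v0] takes values in dimension [2n] and is injective on [S + Y], of rank
   [stab_dim B c + n]. *)
pose L : 'M_(N * N, N) := lin_mul_row v0.
have LE r : r *m L = v0 *m vec_mx r by rewrite -{1}[r]vec_mxK mul_vec_lin_row.
have SYL : ((S + Y)%MS :&: kermx L)%MS = 0.
  apply/eqP/rowV0P => r; rewrite sub_capmx => /andP[/sub_addsmxP[[a1 a2] /= rE] /sub_kermxP].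
  rewrite LE => v0r.
  have [_ e1 s1] := Sst _ (submxMl a1 S); have [_ e2 s2] := Yst' _ (submxMl a2 Y).
  rewrite -[r]vec_mxK; suff -> : vec_mx r = 0 by rewrite linear0.
  apply: v0P v0r; rewrite rE linearD /=; first by rewrite mulmxDl mulmxDr e1 e2.
  move=> z ze; rewrite /lie_br mulmxDl [z *m _]mulmxDr opprD addrACA mulmxDr linearD /=.
  by rewrite [X in X + _](s1 z ze) [X in _ + X](s2 z ze) addr0.
have /mxrank_injP inj : ((S + Y)%MS :&: kermx L)%MS == 0 by apply/eqP.
have := rank_leq_col ((S + Y)%MS *m L); rewrite inj.
by rewrite mxrank_disjoint_sum // rS (eqP Yfree) leq_add2r.
Qed.

End Centraliser.

(** * The plane of regular forms *)

Section RegularPlane.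
Context (K : fieldType) (n : nat).
Local Notation N := (n + n)%N.
Local Notation J := (symp_J K n).
Context (e : 'M[K]_N) (k : nat) (D : nat -> nat) (w : nat -> 'rV[K]_N).
Context (pr : nat -> nat) (c : nat -> K).
Hypothesis K2 : (2%:R : K) != 0.
Hypothesis eJ : symp_sign J 1 e.
Hypothesis sj : symp_jordan J e k D w pr c.
Hypothesis complete : forall v, sj_perp J e k w v -> v = 0.

(* The element of sp dual to the form [y |-> \sum_(a, b) m a b * omega (w a) (w b *m y)]. *)
Definition sp_elt (m : nat -> nat -> K) : 'M[K]_N :=
  - \sum_(a < k) \sum_(b < k) m a b *: (J *m (w a)^T *m w b).

Lemma sp_elt_sign m : (forall a b, (a < k)%N -> (b < k)%N -> m a b = m b a) ->
  symp_sign J 1 (sp_elt m).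
Proof.
move=> msym; rewrite /symp_sign /sp_elt expr1 scaleN1r linearN /= mulmxN !mulNmx; congr (- _).
rewrite mulmx_suml linear_sum mulmx_sumr -sumrN.
under [LHS]eq_bigr do rewrite mulmx_suml.
under [RHS]eq_bigr do rewrite linear_sum mulmx_sumr -sumrN.
rewrite exchange_big; apply: eq_bigr => a _; apply: eq_bigr => b _ /=.
rewrite linearZ /= -scalemxAl -scalemxAr -scalerN msym //; congr (_ *: _).
by rewrite !trmx_mul trmxK tr_symp_J !mulmxN opprK !mulmxA.
Qed.

Lemma tr_sp_elt m y :
  \tr (sp_elt m *m y) = \sum_(a < k) \sum_(b < k) m a b * omega J (w a) (w b *m y).
Proof.
rewrite /sp_elt mulNmx linearN /= mulmx_suml linear_sum -sumrN; apply: eq_bigr => a _ /=.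
rewrite mulmx_suml linear_sum -sumrN; apply: eq_bigr => b _ /=.
rewrite -scalemxAl linearZ /= -mulrN; congr (_ * _).
rewrite omegaC ?tr_symp_J //; congr (- _).
by rewrite -[_ *m w b *m y]mulmxA mxtrace_mulC trace_mx11 mulmxA.
Qed.

(** The coefficient matrix that [jordan_form] needs for [sp_elt m]: pairing with [w a] is [c a]
    times the functional [sj_phi] of index [pr a]. *)
Definition sp_coef (m : nat -> nat -> K) (i j : nat) := c (pr j) * m (pr j) i.

Lemma tr_sp_elt_jordan m y :
  \tr (sp_elt m *m y) = jordan_form k w (sj_phi J w pr c) (sp_coef m) y.
Proof.
rewrite tr_sp_elt exchange_big; apply: eq_bigr => i _ /=.
pose h (j : 'I_k) := Ordinal (sj_pr_lt sj (ltn_ord j)).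
have hK : involutive h by move=> j; apply: val_inj; rewrite /= (sj_prK sj).
rewrite (reindex_inj (inv_inj hK)); apply: eq_bigr => j _ /=.
rewrite sj_phiE /sp_coef mulrA; congr (_ * _); rewrite mulrAC mulfV ?mul1r //.
by rewrite (sj_c_neq0 sj) // (sj_pr_lt sj).
Qed.

Lemma sp_elt_stab m y : (forall z, z *m e = e *m z -> \tr (sp_elt m *m lie_br y z) = 0) ->
  forall z, z *m e = e *m z ->
  jordan_form k w (sj_phi J w pr c) (sp_coef m) (y *m z) =
  jordan_form k w (sj_phi J w pr c) (sp_coef m) (z *m y).
Proof.
move=> h z /h; rewrite -!tr_sp_elt_jordan /lie_br mulmxBr linearB /= => /eqP.
by rewrite subr_eq0 => /eqP.
Qed.

Lemma sj_separated (v : 'rV_N) :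
  (forall l t, (l < k)%N -> (v *m e ^+ t *m sj_phi J w pr c l) 0 0 = 0) -> v = 0.
Proof. by move/(sj_perp_phi sj)/complete. Qed.

(* The diagonal point of the plane; the value at [i] is
   [\pm a] with [a] depending only on the orbit of [i] under [pr]. *)
Definition diag_pt (a : nat -> K) i j : K :=
  if j == pr i then (if (i <= pr i)%N then a i / c (pr i) else a (pr i) / c i) else 0.

(** The first condition gives the subdiagonal of [sp_coef]; the second makes the matrix symmetric,
    so that [sp_elt] lies in sp. *)
Definition subdiag_pt i j : K := ((j == (pr i).+1) || (i == (pr j).+1))%:R.

Lemma diag_pt_sym a i j : (i < k)%N -> (j < k)%N -> diag_pt a i j = diag_pt a j i.
Proof.
move=> ik jk; rewrite /diag_pt; have [jE|jNi] := eqVneq j (pr i).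
  rewrite jE (sj_prK sj) // eqxx.
  by have [lt|gt|<-] := ltngtP i (pr i).
by have [iE|//] := eqVneq i (pr j); case/eqP: jNi; rewrite iE (sj_prK sj).
Qed.

Lemma diag_coef a i : (i < k)%N ->
  sp_coef (diag_pt a) i i = if (i <= pr i)%N then a i else - a (pr i).
Proof.
move=> ik; have pik := sj_pr_lt sj ik.
rewrite /sp_coef /diag_pt (sj_prK sj) // eqxx.
have ci := sj_c_neq0 sj ik; have cpi := sj_c_neq0 sj pik.
have [lt|gt|E] := ltngtP i (pr i).
- by rewrite mulrC divfK.
- by rewrite (sj_c_pr sj) ?neq_ltn ?gt // mulNr mulrC divfK.
by rewrite -E mulrC divfK.
Qed.

Lemma diag_coef_offdiag a i j : (i < k)%N -> (j < k)%N -> i != j ->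
  sp_coef (diag_pt a) i j = 0.
Proof.
move=> ik jk ij; rewrite /sp_coef /diag_pt (sj_prK sj) // (negPf ij).
by rewrite mulr0.
Qed.

(** Adjacency of dual blocks enters here: an entry with [pr j = (pr i).+1] satisfies
    [i <= (pr i).+1 = pr j <= j.+1]. *)
Lemma subdiag_coef_hess i j : (i < k)%N -> (j.+1 < i)%N -> sp_coef subdiag_pt i j = 0.
Proof.
move=> ik ji; have jk : (j < k)%N by apply: ltn_trans ik; apply: ltn_trans ji.
rewrite /sp_coef /subdiag_pt (sj_prK sj) // gtn_eqF //=.
rewrite (_ : _ == _ = false) ?mulr0 //; apply/negP => /eqP E.
have := sj_pr_near sj ik; have := sj_pr_near sj jk; lia.
Qed.

Lemma subdiag_coef_neq0 j : (j.+1 < k)%N -> sp_coef subdiag_pt j.+1 j != 0.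
Proof.
move=> jk; have jk' := ltnW jk; rewrite /sp_coef /subdiag_pt (sj_prK sj) // eqxx mulr1.
by rewrite (sj_c_neq0 sj) // (sj_pr_lt sj).
Qed.

Lemma subdiag_pt_sym i j : subdiag_pt i j = subdiag_pt j i.
Proof. by rewrite /subdiag_pt orbC. Qed.

Definition pencil_pt a s t i j : K := s * diag_pt a i j + t * subdiag_pt i j.

Lemma sp_elt_pencil a s t :
  sp_elt (pencil_pt a s t) = s *: sp_elt (diag_pt a) + t *: sp_elt subdiag_pt.
Proof.
rewrite /sp_elt !scalerN -opprD; congr (- _).
rewrite !scaler_sumr -big_split; apply: eq_bigr => i _ /=.
rewrite !scaler_sumr -big_split; apply: eq_bigr => j _ /=.
by rewrite !scalerA -scalerDl.
Qed.

Lemma sp_coef_pencil a s t i j :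
  sp_coef (pencil_pt a s t) i j = s * sp_coef (diag_pt a) i j + t * sp_coef subdiag_pt i j.
Proof. by rewrite /sp_coef /pencil_pt mulrDr !(mulrCA (c _)). Qed.

Lemma pencil_sign a s t : symp_sign J 1 (sp_elt (pencil_pt a s t)).
Proof.
apply: sp_elt_sign => i j ik jk; rewrite /pencil_pt diag_pt_sym //.
by rewrite subdiag_pt_sym.
Qed.

(** For nonzero [t] the matrix is Hessenberg with nonzero subdiagonal, and [v0] is [w 0]; for
    [t = 0] it is diagonal, and [v0] is the sum of the generators. *)
Lemma pencil_regular a s t : (s != 0) || (t != 0) ->
  (forall i, (i < k)%N -> a i != 0) ->
  (forall i j, (i < k)%N -> (j < k)%N -> a i ^+ 2 = a j ^+ 2 -> i = j) ->
  exists v0 : 'rV_N, forall y, y *m e = e *m y ->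
    (forall z, z *m e = e *m z -> \tr (sp_elt (pencil_pt a s t) *m lie_br y z) = 0) ->
    v0 *m y = 0 -> y = 0.
Proof.
move=> st a0 ainj; have [t0|t0] := eqVneq t 0.
  have s0 : s != 0 by move: st; rewrite t0 eqxx orbF.
  exists (\sum_(i < k) w i) => y ye /sp_elt_stab yst.
  apply: (diagonal_regular (sj_w_phi sj) (sj_phiD (tr_symp_J K n) eJ sj) (sj_exp0 sj) sj_separated ye yst (sj_gt0 sj) _ _ _).
  - by move=> i j ik jk ij; rewrite sp_coef_pencil diag_coef_offdiag // t0 mulr0 mul0r addr0.
  - move=> i ik; rewrite sp_coef_pencil t0 mul0r addr0 mulf_neq0 // diag_coef //.
    by case: ifP => _; rewrite ?oppr_eq0 a0 // (sj_pr_lt sj).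
  move=> i j ik jk ij; have pik := sj_pr_lt sj ik; have pjk := sj_pr_lt sj jk.
  rewrite !sp_coef_pencil t0 !mul0r !addr0 (inj_eq (mulfI s0)) !diag_coef //.
  have opp_neq l : (l < k)%N -> a l <> - a l.
    by move=> lk /(eq_opp0 K2) E; have := a0 l lk; rewrite E eqxx.
  have sq (b1 b2 : K) : b1 = - b2 -> b1 ^+ 2 = b2 ^+ 2 by move=> ->; rewrite sqrrN.
  (* Equal entries have equal squares, hence the same index; opposite signs at the same index are
     excluded by 2 being nonzero. *)
  case: ifP => hi; case: ifP => hj; apply/eqP => E.
  - by case/eqP: ij; apply: ainj => //; rewrite E.
  - by have iE := ainj _ _ ik pjk (sq _ _ E); rewrite -iE in E; apply: (opp_neq i).
  - have jE := ainj _ _ jk pik (sq _ _ (esym E)); rewrite -jE in E.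
    exact: (opp_neq j jk (esym E)).
  case/eqP: ij; rewrite -(sj_prK sj ik) -(sj_prK sj jk); congr pr.
  by apply: ainj => //; rewrite (oppr_inj E).
exists (w 0) => y ye /sp_elt_stab yst.
apply: (hessenberg_regular (sj_w_phi sj) (sj_phiD (tr_symp_J K n) eJ sj) (sj_exp0 sj) sj_separated ye yst (sj_gt0 sj) _ _ _).
- exact: sj_dec sj.
- move=> i j ik ji; rewrite sp_coef_pencil subdiag_coef_hess // mulr0 addr0.
  have jk : (j < k)%N by apply: ltn_trans ik; apply: ltn_trans ji.
  by rewrite diag_coef_offdiag ?mulr0 // gtn_eqF // ltnW.
move=> j jk; rewrite sp_coef_pencil diag_coef_offdiag ?(ltnW jk) //; last first.
  by rewrite gtn_eqF.
by rewrite mulr0 add0r mulf_neq0 // subdiag_coef_neq0.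
Qed.

End RegularPlane.

(** * The codimension of the singular set *)

Unset Implicit Arguments.

Theorem theorem3p11 (K : closedFieldType) (n : nat)
    (hchar : (2%:R : K) != 0) (hn : (2 <= n)%N)
    (e : 'M[K]_(n + n)) (he : in_sp e) (hnil : exists k : nat, e ^+ k = 0)
    (d : nat) (B : 'M[K]_(d, (n + n) * (n + n)))
    (hB : is_basis_centraliser e B) :
  codim_ge 2 (sing_set B).
Proof.
have eJ := (in_spE e).1 he; case: hnil => r er.
have [k [D [w [pr [c [sj complete]]]]]] :=
  symp_jordan_exists hchar (tr_symp_J K n) (symp_J_unit K n) eJ er.
have [a [a0 ainj]] := closed_field_squares K k.
pose x1 := sp_elt k w (diag_pt pr c a); pose x2 := sp_elt k w (subdiag_pt K pr).
(* [G l] holds the structure constants at the [l]-th basis element, which exhibits [gam_form] as a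
   matrix of linear forms. *)
pose G l := \matrix_(i < d, j < d) (mxvec (lie_br (bas B i) (bas B j)) *m pinvmx B) 0 l.
pose C := \matrix_(q < 2, i < d) \tr ((if q == 0 then x1 else x2) *m bas B i).
have GE u : lin_mx_at G u = gam_form B u.
  apply/matrixP => i j; rewrite /lin_mx_at summxE mxE; apply: eq_bigr => l _.
  by rewrite !mxE mulrC.
(* Every stabiliser has dimension at least [n], so a singular form, exceeding another stabiliser
   dimension, has rank below [d - n]. *)
apply: (@codim_ge2_of_rank_drop K d d (d - n) G _ C).
  move=> u [u']; rewrite GE /stab_dim !mxrank_ker => lt.
  have := stab_dim_ge hchar eJ hB u'; have := rank_leq_row (gam_form B u).
  rewrite /stab_dim mxrank_ker; lia.
move=> st st0; rewrite GE.
set u := fun i => _; pose s := st 0 0; pose t := st 0 1.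
have stn : (s != 0) || (t != 0).
  apply: contraNT st0; rewrite negb_or !negbK => /andP[/eqP s0 /eqP t0].
  apply/eqP/rowP => -[[|[|//]] hi]; rewrite mxE; [rewrite -[RHS]s0 | rewrite -[RHS]t0];
    by congr (st _ _); apply: val_inj.
have urep : represents B u (sp_elt k w (pencil_pt pr c a s t)).
  move=> y yB; rewrite -(represents_bas _ yB); apply: eq_bigr => i _; congr (_ * _).
  rewrite sp_elt_pencil mulmxDl -!scalemxAl linearD /= !linearZ /=.
  rewrite [LHS]mxE !big_ord_recl big_ord0 addr0 !mxE /=.
  by congr (st _ _ * _ + st _ _ * _); apply: val_inj.
have [v0 v0P] := pencil_regular hchar eJ sj complete stn a0 ainj.
have := stab_dim_le hchar eJ hB (pencil_sign sj a s t) urep v0P.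
rewrite /stab_dim mxrank_ker; have := rank_leq_row (gam_form B u); lia.
Qed.
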